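(* Let $H$ be a fixed graph (pattern). If $H$ is not $3$-colorable, or if $H$ contains more than one triangle, then, assuming the Combinatorial Triangle Detection (BMM) Conjecture, every combinatorial algorithm for Triangle Detection on $n$-vertex $H$-free graphs requires $n^{3-o(1)}$ time.
   Context: Triangle Detection: given a graph $G$, decide whether $G$ contains three pairwise adjacent vertices. A graph $G$ is $H$-free if there is no injective map $\phi: V(H)\to V(G)$ with $\phi(x)\phi(y)\in E(G)$ for every edge $xy\in E(H)$ (i.e., $H$ is not contained as a not-necessarily-induced subgraph). A ''combinatorial'' algorithm is one that does not use fast (algebraic) matrix multiplication. Combinatorial Triangle Detection (BMM) Conjecture: there is no combinatorial algorithm solving Triangle Detection (equivalently, Boolean Matrix Multiplication) on $n$-vertex graphs in time $O(n^{3-\varepsilon})$ for any constant $\varepsilon>0$.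
   Formalization: ''Combinatorial'' has no precise definition: the theorem holds for any chosen class of procedures counted as fast matrix multiplication, provided that procedures doing only near-linear (n^2 polylog n) work outside their subroutine calls never count as such; algorithms are randomized word RAMs. *)

(* Defs.v *)
From mathcomp Require Import all_boot all_order all_algebra.
From mathcomp Require Import reals exp.

Set Implicit Arguments.
Unset Strict Implicit.
Unset Printing Implicit Defensive.

Import Order.TTheory GRing.Theory Num.Theory.

Record sgraph (V : finType) := SGraph {
  adj :> rel V;
  adj_sym : symmetric adj;
  adj_irr : irreflexive adj }.

Definition colorable (k : nat) (V : finType) (H : sgraph V) : Prop :=
  exists c : V -> 'I_k, forall x y, H x y -> c x != c y.

Definition triangles (V : finType) (H : sgraph V) : {set {set V}} :=
  [set S : {set V} | (#|S| == 3) &&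
     [forall x in S, forall y in S, (x != y) ==> H x y]].

Definition has_triangle (V : finType) (G : sgraph V) : bool :=
  0 < #|triangles G|.

Definition H_free (V : finType) (H : sgraph V) (W : finType) (G : sgraph W) :
    Prop :=
  ~ exists phi : V -> W, injective phi /\ forall x y, H x y -> G (phi x) (phi y).

(** A randomized word RAM, programmed in a structured language.
    A procedure of size n acts in place on an n x n array of words; its words
    have [wc * (log2 n + 1)] bits, where the constant [wc] belongs to the
    procedure. Every instruction costs one time unit. *)

Inductive binop :=
 OAdd | OSub | OMul | ODiv | OMod | OLt | OEq | OAnd | OOr | OXor | OShl | OShr.

Inductive expr :=
| Const of nat
| Reg of nat
| Peek of expr
| Bin of binop & expr & expr.

(** [Call wc c x en ea et] runs the procedure [(wc, c)] with size [en] in a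
    fresh memory, on a copy of the [en ^ 2] words at address [ea], for at most
    [et] time units. If it stops in time, the result is copied back and the
    register [x] is set to 1; otherwise [x] is set to 0. *)
Inductive cmd :=
| Skip
| Assign of nat & expr
| Store of expr & expr
| Flip of nat
| Seq of cmd & cmd
| If of expr & cmd & cmd
| While of expr & cmd
| Call of nat & cmd & nat & expr & expr & expr.

Definition procedure : Type := (nat * cmd)%type.

Definition word_bits (wc n : nat) : nat := wc * (trunc_log 2 n).+1.

(** [pos] is the number of coins already consumed; [own] is a ghost counter of
    the time spent outside the bodies of called procedures. *)
Record state := State {
  regs : nat -> nat;
  memory : nat -> nat;
  pos : nat;
  own : nat }.

Definition upd (f : nat -> nat) (i v : nat) : nat -> nat :=
  fun j => if j == i then v else f j.

Definition tick (d : nat) (s : state) : state :=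
  State (regs s) (memory s) (pos s) (own s + d).

Definition set_reg (x v : nat) (s : state) : state :=
  State (upd (regs s) x v) (memory s) (pos s) (own s).

Definition binop_sem (o : binop) (a b : nat) : nat :=
  match o with
  | OAdd => a + b
  | OSub => a - b
  | OMul => a * b
  | ODiv => a %/ b
  | OMod => a %% b
  | OLt => a < b
  | OEq => a == b
  | OAnd => Nat.land a b
  | OOr => Nat.lor a b
  | OXor => Nat.lxor a b
  | OShl => a * 2 ^ b
  | OShr => a %/ 2 ^ b
  end.

Fixpoint eval (w : nat) (s : state) (e : expr) : nat :=
  match e with
  | Const v => v %% 2 ^ w
  | Reg x => regs s x
  | Peek e => memory s (eval w s e)
  | Bin o e1 e2 => binop_sem o (eval w s e1) (eval w s e2) %% 2 ^ w
  end.

(** The initial state for size [n] and input array [A] (row by row), where the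
    first [p] coins have already been used. *)
Definition init (w n : nat) (A : nat -> nat) (p : nat) : state :=
  State (upd (fun=> 0) 0 (n %% 2 ^ w))
        (fun i => if i < n * n then A i %% 2 ^ w else 0) p 0.

(** Copies the [n * n] first words of [B] to address [a]. *)
Definition blit (w n a : nat) (B : nat -> nat) (f : nat -> nat) : nat -> nat :=
  fun j => if (a <= j) && (j < a + n * n) then B (j - a) %% 2 ^ w else f j.

(** [exec tape c w k s] runs [c] from [s] with [k] time units left. It returns
    the time left and the final state, or [None] if [c] does not stop in time.
    An interrupted call is charged its full time limit, and that many coins are
    discarded. *)
Fixpoint exec (tape : nat -> bool) (c : cmd) (w k : nat) (s : state)
    {struct c} : option (nat * state) :=
  match c with
  | Skip => if k is k'.+1 then Some (k', tick 1 s) else None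
  | Assign x e =>
      if k is k'.+1 then Some (k', tick 1 (set_reg x (eval w s e) s)) else None
  | Store e1 e2 =>
      if k is k'.+1 then
        Some (k', tick 1 (State (regs s)
                           (upd (memory s) (eval w s e1) (eval w s e2))
                           (pos s) (own s)))
      else None
  | Flip x =>
      if k is k'.+1 then
        Some (k', tick 1 (State (upd (regs s) x (tape (pos s) %% 2 ^ w)) (memory s)
                           (pos s).+1 (own s)))
      else None
  | Seq c1 c2 =>
      if exec tape c1 w k s is Some (k', s') then exec tape c2 w k' s' else None
  | If e c1 c2 =>
      if k is k'.+1 then
        exec tape (if eval w s e != 0 then c1 else c2) w k' (tick 1 s)
      else None
  | While e c1 =>
      (* each test costs one unit, so at most [k] rounds are possible *)
      (fix loop (rounds k : nat) (s : state) {struct rounds} :=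
         if k is k'.+1 then
           if eval w s e != 0 then
             if rounds is rounds'.+1 then
               if exec tape c1 w k' (tick 1 s) is Some (k2, s2)
               then loop rounds' k2 s2 else None
             else None
           else Some (k', tick 1 s)
         else None) k k s
  | Call wc c1 x en ea et =>
      let n := eval w s en in
      let a := eval w s ea in
      let t := eval w s et in
      let cost := (n * n).+1 in
      if k < cost then None else
      let k' := k - cost in
      let b := minn t k' in
      let w1 := word_bits wc n in
      match exec tape c1 w1 b (init w1 n (fun i => memory s (a + i)) (pos s)) with
      | Some (b', s1) =>
          Some (k' - (b - b'),
                State (upd (regs s) x (1 %% 2 ^ w)) (blit w n a (memory s1) (memory s))
                      (pos s1) (own s + cost))
      | None =>
          if t <= k' then
            Some (k' - t,
                  State (upd (regs s) x 0) (memory s) (pos s + t) (own s + cost))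
          else None
      end
  end.

Definition run (P : procedure) (tape : nat -> bool) (n : nat) (A : nat -> nat)
    (k : nat) : option (nat * state) :=
  let w := word_bits P.1 n in exec tape P.2 w k (init w n A 0).

(** Row-by-row adjacency matrix. *)
Definition adj_array (n : nat) (G : sgraph 'I_n) : nat -> nat :=
  fun k => [exists i : 'I_n, exists j : 'I_n, (k == i * n + j) && G i j].

Definition halts_within (P : procedure) (n : nat) (G : sgraph 'I_n) (t : nat) :
    Prop :=
  forall tape, run P tape n (adj_array G) t <> None.

(** The answer of a decision procedure is whether the word at address 0 of its
    final memory is nonzero. *)
Definition answers (P : procedure) (n : nat) (G : sgraph 'I_n) (t : nat)
    (tape : nat -> bool) (b : bool) : bool :=
  if run P tape n (adj_array G) t is Some (_, s) then (memory s 0 != 0) == b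
  else false.

(** A promise on the input graphs. *)
Definition promise : Type := forall n : nat, sgraph 'I_n -> Prop.

Definition all_graphs : promise := fun _ _ => True.

Definition free_graphs (V : finType) (H : sgraph V) : promise :=
  fun _ G => H_free H G.

(** Monte Carlo algorithm: on each promised input the answer is right with
    probability at least 2/3. Within time [t] at most [t] coins are used, so the
    probability is over [t] uniform bits. *)
Definition detects_triangles (P : procedure) (Phi : promise) : Prop :=
  forall (n : nat) (G : sgraph 'I_n), 0 < n -> Phi n G ->
  exists t : nat, halts_within P G t /\
    2 * 2 ^ t <=
    3 * #|[set r : t.-tuple bool |
             answers P G t (nth false r) (has_triangle G)]|.

(** Worst-case time O(n ^ e) on the promised inputs. *)
Definition time_bigO (R : realType) (P : procedure) (Phi : promise) (e : R) :
    Prop :=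
  exists C : R, forall (n : nat) (G : sgraph 'I_n), 0 < n -> Phi n G ->
  exists t : nat, halts_within P G t /\ (t%:R <= C * n%:R `^ e)%R.

(** "Combinatorial" has no precise definition in the literature beyond "does
    not use fast matrix multiplication". Here [fmm] is an arbitrary set of
    procedures, read as "the code of this procedure, calls excluded, carries
    out fast matrix multiplication", and a procedure is combinatorial if
    neither itself nor any procedure it calls, directly or not, is in [fmm]. *)

Fixpoint calls_some (fmm : procedure -> Prop) (c : cmd) : Prop :=
  match c with
  | Seq c1 c2 | If _ c1 c2 => calls_some fmm c1 \/ calls_some fmm c2
  | While _ c1 => calls_some fmm c1
  | Call wc c1 _ _ _ _ => fmm (wc, c1) \/ calls_some fmm c1
  | _ => False
  end.

Definition combinatorial (fmm : procedure -> Prop) (P : procedure) : Prop :=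
  ~ (fmm P \/ calls_some fmm P.2).

(** The time spent outside called procedures is near-linear in the size n ^ 2
    of the input, on every input array. *)
Definition near_linear_glue (P : procedure) : Prop :=
  exists C : nat, forall (n : nat) (A : nat -> nat) (tape : nat -> bool), 0 < n ->
  exists k k' s, run P tape n A k = Some (k', s) /\
    own s <= C * n ^ 2 * (trunc_log 2 n).+1 ^ C.

(** The only requirement on [fmm]: code that does near-linear work outside its
    calls does not count as fast matrix multiplication. *)
Definition fmm_notion (fmm : procedure -> Prop) : Prop :=
  forall P, near_linear_glue P -> ~ fmm P.

Definition BMM_conjecture (R : realType) (fmm : procedure -> Prop) : Prop :=
  forall eps : R, (0 < eps)%R ->
  ~ exists P : procedure, [/\ combinatorial fmm P,
      detects_triangles P all_graphs & time_bigO P all_graphs (3 - eps)%R].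

(** Time n ^ (3 - o(1)) is required, i.e. time O(n ^ (3 - eps)) is impossible
    for every eps > 0. *)
Definition requires_cubic_time (R : realType) (P : procedure) (Phi : promise) :
    Prop :=
  forall eps : R, (0 < eps)%R -> ~ time_bigO P Phi (3 - eps)%R.

(* Main.v *)
(** Triangle detection on an arbitrary graph [G] reduces to polylogarithmically
    many calls to [P] on graphs that are [H]-free for every admissible [H]: a
    3-partite graph with at most one triangle contains neither a graph that is
    not 3-colorable nor a graph with two triangles. Such a graph is obtained by
    taking three copies of the vertex set of [G] and keeping each vertex of a
    copy with probability [2^-l], for all triples of levels [l]. If [G] has a
    triangle, then at suitable levels the sample contains exactly one with
    constant probability: first isolate a vertex [a] of the first copy that lies
    in a triangle, then a vertex [b] of the second copy that lies in a triangle
    with [a], then a third vertex. If [G] has no triangle, no sample has one. So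
    repeating the sampling and taking on each sample the majority of [O(log n)]
    runs of [P] decides [G]. Since [P] is only called with an explicit time
    limit, the reduction stops in time on every input, including samples that
    violate the promise, and outside its calls it does [n^2 polylog n] work.

    The behaviour of a program on a random tape is a decision tree whose inner
    nodes are coin flips; sequential composition of programs is then the monadic
    bind of trees, and stages that read a varying number of coins cause no
    difficulty. *)

Require Import Defs.
From mathcomp Require Import all_boot all_order all_algebra.
From mathcomp Require Import reals exp.
From mathcomp Require Import boolp zify lra.

Set Implicit Arguments.
Unset Strict Implicit.
Unset Printing Implicit Defensive.

Import Order.TTheory GRing.Theory Num.Theory.

(** * Decision trees and the semantics of programs *)

Inductive dtree (X : Type) := Ret of X | Coin of bool -> dtree X.

Fixpoint tbind X Y (t : dtree X) (f : X -> dtree Y) : dtree Y :=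
  match t with
  | Ret x => f x
  | Coin g => Coin (fun b => tbind (g b) f)
  end.

Fixpoint trun X (t : dtree X) (tape : nat -> bool) (p : nat) : X * nat :=
  match t with
  | Ret x => (x, p)
  | Coin g => trun (g (tape p)) tape p.+1
  end.

Lemma trun_bind X Y (t : dtree X) (f : X -> dtree Y) tape p :
  trun (tbind t f) tape p =
  let: (x, p') := trun t tape p in trun (f x) tape p'.
Proof. by elim: t p => //= g IH p; rewrite IH. Qed.

(** Expectation over fair coins; on an indicator it is a probability. Coins only average, so
    rational values suffice. *)
Fixpoint pr X (t : dtree X) (f : X -> rat) : rat :=
  match t with
  | Ret x => f x
  | Coin g => ((pr (g true) f + pr (g false) f) / 2)%R
  end.

Lemma pr_bind X Y (t : dtree X) (f : X -> dtree Y) h :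
  pr (tbind t f) h = pr t (fun x => pr (f x) h).
Proof. by elim: t => //= g IH; rewrite !IH. Qed.

Lemma eq_pr X (t : dtree X) (f g : X -> rat) : f =1 g -> pr t f = pr t g.
Proof. by move=> fg; elim: t => //= h IH; rewrite !IH. Qed.

Lemma ler_pr X (t : dtree X) (f g : X -> rat) :
  (forall x, f x <= g x)%R -> (pr t f <= pr t g)%R.
Proof.
move=> fg; elim: t => //= h IH.
by rewrite ler_wpM2r ?invr_ge0 ?ler0n // lerD.
Qed.

Lemma pr_cst X (t : dtree X) (a : rat) : pr t (fun=> a) = a.
Proof. by elim: t => //= h IH; rewrite !IH; lra. Qed.

Lemma prZ X (t : dtree X) (a : rat) f :
  pr t (fun x => a * f x)%R = (a * pr t f)%R.
Proof. by elim: t => //= h IH; rewrite !IH; lra. Qed.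

Lemma prD X (t : dtree X) f g :
  pr t (fun x => f x + g x)%R = (pr t f + pr t g)%R.
Proof. by elim: t => //= h IH; rewrite !IH; lra. Qed.

Lemma pr_sum X (t : dtree X) m (F : 'I_m -> X -> rat) :
  pr t (fun x => \sum_(i < m) F i x)%R = (\sum_(i < m) pr t (F i))%R.
Proof.
elim: t => //= h IH.
by rewrite !IH -big_split /= mulr_suml; apply: eq_bigr.
Qed.

Lemma pr_negb X (t : dtree X) (f : X -> bool) :
  pr t (fun x => (~~ f x)%:R)%R = (1 - pr t (fun x => (f x)%:R))%R.
Proof.
apply/eqP; rewrite eq_sym subr_eq -prD eq_sym; apply/eqP.
rewrite -[RHS](pr_cst t); apply: eq_pr => x.
by case: (f x); rewrite /= ?addr0 ?add0r.
Qed.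

Fixpoint depth X (t : dtree X) : nat :=
  match t with
  | Ret _ => 0
  | Coin g => (maxn (depth (g true)) (depth (g false))).+1
  end.

Lemma trun_shift X (t : dtree X) tape p :
  (trun t tape p.+1).1 = (trun t (fun i => tape i.+1) p).1.
Proof. by elim: t p => //= g IH p; rewrite IH. Qed.

Lemma sum_tuple_bool T (F : T.+1.-tuple bool -> nat) :
  \sum_(r : T.+1.-tuple bool) F r =
  \sum_(b : bool) \sum_(r : T.-tuple bool) F [tuple of b :: r].
Proof.
rewrite pair_big /=.
rewrite (reindex (fun z : bool * T.-tuple bool => [tuple of z.1 :: z.2])) //.
exists (fun r : T.+1.-tuple bool => (thead r, [tuple of behead r])).
  by move=> [b r] _ /=; rewrite theadE; congr pair; apply: val_inj.
by move=> r _ /=; rewrite -tuple_eta.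
Qed.

(** Coins beyond the depth are never read, so each merely doubles both sides. This turns counting
    tapes into [pr]. *)
Lemma pr_count X (t : dtree X) (f : X -> bool) T : depth t <= T ->
  (#|[set r : T.-tuple bool | f (trun t (nth false r) 0).1]|%:R =
   2 ^+ T * pr t (fun x => (f x)%:R) :> rat)%R.
Proof.
rewrite -sum1dep_card big_mkcond /=.
elim: t T => [x|g IH] T /=.
  by rewrite sum_nat_const card_tuple card_bool natrM natrX; case: (f x).
case: T => // T; rewrite ltnS geq_max => /andP[dT dF].
rewrite sum_tuple_bool /= big_bool /= natrD.
under eq_bigr => r _ do rewrite trun_shift.
rewrite (IH true T) //.
under eq_bigr => r _ do rewrite trun_shift.
rewrite (IH false T) // exprS; lra.
Qed.

(** Both sides count tapes long enough for both trees; the trees may differ in shape and in the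
    number of coins read. *)
Lemma eq_pr_trun X Y (t : dtree X) (u : dtree Y) (f : X -> bool) (g : Y -> bool) :
  (forall tape, f (trun t tape 0).1 = g (trun u tape 0).1) ->
  pr t (fun x => (f x)%:R)%R = pr u (fun y => (g y)%:R)%R.
Proof.
move=> fg; pose T := maxn (depth t) (depth u).
have h2 : (2 ^+ T != 0 :> rat)%R by rewrite expf_neq0.
apply: (mulfI h2).
rewrite -!pr_count ?leq_max ?leqnn ?orbT //; congr (_%:R)%R; apply: eq_card => r.
by rewrite !inE fg.
Qed.

Fixpoint iterM X (f : nat -> X -> dtree X) (i r : nat) (x : X) : dtree X :=
  if r is r'.+1 then tbind (f i x) (iterM f i.+1 r') else Ret x.

(** The anonymous loop inside [exec], with its body abstracted, so that inductions on [rounds] can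
    be stated. *)
Definition loop (body : nat -> state -> option (nat * state)) w e :=
  fix loop (rounds k : nat) (s : state) {struct rounds} :=
    if k is k'.+1 then
      if eval w s e != 0 then
        if rounds is rounds'.+1 then
          if body k' (tick 1 s) is Some (k2, s2)
          then loop rounds' k2 s2 else None
        else None
      else Some (k', tick 1 s)
    else None.

Lemma exec_While tape e c w k s :
  exec tape (While e c) w k s = loop (exec tape c w) w e k k s.
Proof. by []. Qed.

(** Spare fuel is returned untouched. The delicate case is [Call], whose inner budget is the minimum
    of the time limit and the fuel at hand. *)
Lemma exec_addfuel tape c w k s k' s' d :
  exec tape c w k s = Some (k', s') ->
  exec tape c w (k + d) s = Some (k' + d, s').
Proof.
elim: c w k s k' s' d => [|x e|e1 e2|x|c1 IH1 c2 IH2|e c1 IH1 c2 IH2|e c IH|wc c IH x en ea et] w k s k' s' d.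
- by case: k => //= k [<- <-].
- by case: k => //= k [<- <-].
- by case: k => //= k [<- <-].
- by case: k => //= k [<- <-].
- rewrite /=; case E: (exec tape c1 w k s) => [[k1 s1]|//] H.
  by rewrite (IH1 _ _ _ _ _ _ E) (IH2 _ _ _ _ _ _ H).
- by case: k => //= k; case: ifP => _ H; [apply: IH1 | apply: IH2].
- rewrite !exec_While.
  (* Rounds and fuel start equal but decrease at different rates, so they are generalised
     separately. *)
  suff H r : loop (exec tape c w) w e r k s = Some (k', s') ->
     loop (exec tape c w) w e (r + d) (k + d) s = Some (k' + d, s') by apply: H.
  elim: r k s => [|r IHr] [|k] s //=.
    case: ifP => // eN [<- <-]; rewrite add0n; case: (d) => [|d'];
    by rewrite /= ?eN ?addn0.
  case: ifP => [_|_ [<- <-]] //.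
  case E: (exec tape c w k (tick 1 s)) => [[k1 s1]|//] H.
  by rewrite (IH _ _ _ _ _ _ E); apply: IHr.
- rewrite /=.
  set n := eval w s en; set t := eval w s et.
  case: (ltnP k (n * n).+1) => // kn.
  rewrite ltnNge (leq_trans kn) ?leq_addr //=.
  have -> : k + d - (n * n).+1 = k - (n * n).+1 + d by lia.
  set K := k - (n * n).+1.
  set st := init _ _ _ _.
  case E: (exec tape c _ (minn t K) st) => [[b' s1]|].
    move=> [<- <-].
    have -> : minn t (K + d) = minn t K + (minn t (K + d) - minn t K) by lia.
    rewrite (IH _ _ _ _ _ _ E); congr (Some (_, _)).
    lia.
  case: ifP => // tK [<- <-].
  (* An interruption is survived only if the limit already fitted into the fuel, so extra fuel does
     not lengthen the call. *)
  have -> : minn t (K + d) = minn t K by lia.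
  rewrite E (leq_trans tK) ?leq_addr //; congr (Some (_, _)); lia.
Qed.

(** * The decision tree of a command *)

Definition at_pos (p : nat) (s : state) : state :=
  State (regs s) (memory s) p (own s).

(** An interrupted call discards coins up to its time limit. *)
Fixpoint pad X (d : nat) (t : dtree (option X)) : dtree (option X) :=
  match t with
  | Ret (Some x) => Ret (Some x)
  | Ret None => iterM (fun _ o => Coin (fun=> Ret o)) 0 d None
  | Coin g => Coin (fun b => pad d.-1 (g b))
  end.

(** [exec] with every coin turned into a branch. The field [pos] is never advanced here and a callee
    starts at position 0: the tape position is tracked by [trun]. *)
Fixpoint texec (c : cmd) (w k : nat) (s : state) {struct c} :
    dtree (option (nat * state)) :=
  match c with
  | Skip => Ret (if k is k'.+1 then Some (k', tick 1 s) else None)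
  | Assign x e =>
      Ret (if k is k'.+1 then Some (k', tick 1 (set_reg x (eval w s e) s)) else None)
  | Store e1 e2 =>
      Ret (if k is k'.+1 then
             Some (k', tick 1 (State (regs s)
                           (upd (memory s) (eval w s e1) (eval w s e2))
                           (pos s) (own s)))
           else None)
  | Flip x =>
      if k is k'.+1 then
        Coin (fun b => Ret (Some (k', tick 1 (set_reg x (b %% 2 ^ w) s))))
      else Ret None
  | Seq c1 c2 =>
      tbind (texec c1 w k s) (fun o =>
        if o is Some (k', s') then texec c2 w k' s' else Ret None)
  | If e c1 c2 =>
      if k is k'.+1 then
        texec (if eval w s e != 0 then c1 else c2) w k' (tick 1 s)
      else Ret None
  | While e c1 =>
      (fix loop (rounds k : nat) (s : state) {struct rounds} :=
         if k is k'.+1 then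
           if eval w s e != 0 then
             if rounds is rounds'.+1 then
               tbind (texec c1 w k' (tick 1 s)) (fun o =>
                 if o is Some (k2, s2) then loop rounds' k2 s2 else Ret None)
             else Ret None
           else Ret (Some (k', tick 1 s))
         else Ret None) k k s
  | Call wc c1 x en ea et =>
      let n := eval w s en in
      let a := eval w s ea in
      let t := eval w s et in
      let cost := (n * n).+1 in
      if k < cost then Ret None else
      let k' := k - cost in
      let b := minn t k' in
      let w1 := word_bits wc n in
      tbind (pad b (texec c1 w1 b (init w1 n (fun i => memory s (a + i)) 0)))
        (fun o => Ret (match o with
         | Some (b', s1) =>
          Some (k' - (b - b'),
                State (upd (regs s) x (1 %% 2 ^ w)) (blit w n a (memory s1) (memory s))
                      (pos s) (own s + cost))
         | None =>
          if t <= k' then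
            Some (k' - t, State (upd (regs s) x 0) (memory s) (pos s) (own s + cost))
          else None
         end))
  end.

Definition tloop (body : nat -> state -> dtree (option (nat * state))) w e :=
  fix loop (rounds k : nat) (s : state) {struct rounds} :=
    if k is k'.+1 then
      if eval w s e != 0 then
        if rounds is rounds'.+1 then
          tbind (body k' (tick 1 s)) (fun o =>
            if o is Some (k2, s2) then loop rounds' k2 s2 else Ret None)
        else Ret None
      else Ret (Some (k', tick 1 s))
    else Ret None.

Lemma texec_While e c w k s :
  texec (While e c) w k s = tloop (texec c w) w e k k s.
Proof. by []. Qed.

Lemma trun_pad X d (t : dtree (option X)) tape p :
  depth t <= d ->
  trun (pad d t) tape p =
  if (trun t tape p).1 is Some x then trun t tape p else (None, p + d).
Proof.
elim: t d p => [[x|]|g IH] d p //=.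
  move=> _; elim: d p 0 => [|d IHd] p i /=; first by rewrite addn0.
  by rewrite IHd addSnnS.
case: d => // d; rewrite ltnS geq_max => /andP[dT dF] /=.
by rewrite IH ?addSnnS //; case: (tape p).
Qed.

(** Each coin is paid for by a unit of fuel, and unspent fuel is recorded at the leaf. A bound on
    the depth alone would not compose, since the second command of a sequence runs on what the first
    one leaves. *)
Fixpoint fueled (k : nat) (t : dtree (option (nat * state))) : bool :=
  match t with
  | Ret (Some (k', _)) => k' <= k
  | Ret None => true
  | Coin g => (0 < k) && [forall b, fueled k.-1 (g b)]
  end.

Lemma fueled_depth k t : fueled k t -> depth t <= k.
Proof.
elim: t k => [[[]|]|g IH] k //= /andP[k0 /forallP gk].
by case: k k0 gk => // k _ gk; rewrite ltnS geq_max !IH.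
Qed.

Lemma fueledW k k' t : k <= k' -> fueled k t -> fueled k' t.
Proof.
elim: t k k' => [[[k1 s]|]|g IH] k k' //= kk'; first by move/leq_trans; apply.
case/andP=> k0 /forallP gk; rewrite (leq_trans k0) //=.
by apply/forallP => b; apply: (IH _ k.-1) => //; lia.
Qed.

Lemma fueled_bind k t f : fueled k t ->
  (forall k' s, k' <= k -> fueled k' (f (Some (k', s)))) -> f None = Ret None ->
  fueled k (tbind t f).
Proof.
move=> + + fN; elim: t k => [[[k1 s]|]|g IH] k /=.
- by move=> k1k /(_ k1 s k1k); apply: fueledW.
- by rewrite fN.
case/andP=> k0 /forallP gk fk; rewrite k0 /=; apply/forallP => b.
by apply: IH => // k' s kk; apply: fk; lia.
Qed.

(** A call that stops is charged [b - b'], which covers its coins; an interrupted one is charged its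
    limit, which covers the discarded coins. *)
Lemma fueled_pad k b t (F : option (nat * state) -> option (nat * state)) :
  fueled b t -> b <= k ->
  (forall b' s k' s', b' <= b -> F (Some (b', s)) = Some (k', s') ->
     k' + (b - b') <= k) ->
  (forall k' s', F None = Some (k', s') -> k' + b <= k) ->
  fueled k (tbind (pad b t) (fun o => Ret (F o))).
Proof.
elim: t b k => [[[k1 s]|]|h IH] b k /=.
- move=> k1b bk FS _; case E: F => [[k2 s2]|] //.
  by have := FS _ _ _ _ k1b E; lia.
- move=> _ + _ FN; elim: b k 0 FN => [|b IHb] k i FN bk /=.
    by case E: F => [[k2 s2]|] //; have := FN _ _ E; rewrite addn0.
  apply/andP; split; first lia.
  apply/forallP=> _; apply: IHb; last lia.
  by move=> k' s' /FN; lia.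
move=> /andP[b0 /forallP hb] bk FS FN.
apply/andP; split; first lia.
apply/forallP => c; apply: IH => //.
- lia.
- by move=> b' s k' s' b'b /FS; lia.
- by move=> k' s' /FN; lia.
Qed.

Lemma fueled_texec c w k s : fueled k (texec c w k s).
Proof.
elim: c w k s => [|x e|e1 e2|x|c1 IH1 c2 IH2|e c1 IH1 c2 IH2|e c IH|wc c IH x en ea et] w k s.
- by case: k => /=.
- by case: k => /=.
- by case: k => /=.
- by case: k => //= k; apply/forallP.
- by apply: fueled_bind.
- case: k => //= k; apply: (@fueledW k) => //; by case: ifP.
- rewrite texec_While; move: {2}k => r; elim: r k s => [|r IHr] [|k] s //=.
    by case: ifP => /=.
  case: ifP => _ //=; apply: (@fueledW k) => //.
  apply: fueled_bind => // k' s' kk; exact: IHr.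
- rewrite /=; set n := eval w s en; set t := eval w s et.
  case: ltnP => // kn; set K := k - _; set b := minn t K.
  apply: fueled_pad; first exact: IH.
  + lia.
  + by move=> b' s1 k' s' b'b [<- _]; lia.
  + by move=> k' s'; case: ifP => // tK [<- _]; lia.
Qed.

Lemma eval_at_pos w p s e : eval w (at_pos p s) e = eval w s e.
Proof. by elim: e => //= [e ->|o e1 -> e2 ->]. Qed.

Definition at_res (op : option (nat * state) * nat) : option (nat * state) :=
  if op.1 is Some (k, s) then Some (k, at_pos op.2 s) else None.

(** The tree reads its coins in the order in which the program consumes them, so the position
    returned by [trun] is the one missing in the leaf; [at_res] puts it back. *)
Lemma exec_texec tape c w k s p :
  exec tape c w k (at_pos p s) = at_res (trun (texec c w k s) tape p).
Proof.
elim: c w k s p => [|x e|e1 e2|x|c1 IH1 c2 IH2|e c1 IH1 c2 IH2|e c IH|wc c IH x en ea et] w k s p.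
- by case: k.
- by case: k => //= k; rewrite eval_at_pos.
- by case: k => //= k; rewrite !eval_at_pos.
- by case: k.
- rewrite /= IH1 trun_bind /at_res; case: trun => -[[k1 s1]|] p1 //=.
- case: k => //= k; rewrite eval_at_pos.
  by case: ifP => _; [rewrite -IH1|rewrite -IH2].
- rewrite texec_While exec_While; move: {1 3}k => r.
  elim: r k s p => [|r IHr] [|k] s p //=; rewrite eval_at_pos.
    by case: ifP.
  case: ifP => _ //.
  rewrite trun_bind -[tick 1 _]/(at_pos p (tick 1 s)) IH /at_res.
  by case: trun => -[[k1 s1]|] p1 //=; rewrite IHr.
- rewrite /= !eval_at_pos; set n := eval w s en; set t := eval w s et.
  case: ltnP => // kn; set K := k - _; set b := minn t K.
  set A := fun i => _.
  (* The initial state of the callee depends on the position only through [pos], so one tree serves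
     every position. *)
  rewrite -[init _ n A p]/(at_pos p (init (word_bits wc n) n A 0)) IH.
  rewrite trun_bind trun_pad ?fueled_depth ?fueled_texec // /at_res.
  case: trun => -[[k1 s1]|] p1 //=.
  (* The tree discards the budget [b], the program the limit [t]; they agree when the limit fits
     into the fuel. *)
  case: ifP => // tK; have -> : b = t by rewrite /b; lia.
  by [].
Qed.

Definition word_state (w : nat) (s : state) : Prop :=
  (forall i, regs s i < 2 ^ w) /\ (forall i, memory s i < 2 ^ w).

Lemma word_upd w f i v :
  (forall j, f j < 2 ^ w) -> v < 2 ^ w -> forall j, upd f i v j < 2 ^ w.
Proof. by move=> fw vw j; rewrite /upd; case: eqP. Qed.

Lemma ltn_pmod2X v w : v %% 2 ^ w < 2 ^ w.
Proof. by rewrite ltn_pmod ?expn_gt0. Qed.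

Lemma word_init w n A p : word_state w (init w n A p).
Proof.
split=> i /=; last by case: ifP => _; rewrite ?ltn_pmod2X ?expn_gt0.
by apply: word_upd; rewrite ?ltn_pmod2X // => j; rewrite expn_gt0.
Qed.

Lemma word_eval w s e : word_state w s -> eval w s e < 2 ^ w.
Proof. by move=> [rs ms]; case: e => //= *; rewrite ltn_pmod2X. Qed.

(** Needed for callees: their answer word fits their own word size, so a caller with words at least
    as long copies it back without truncation. *)
Lemma word_exec tape c w k s k' s' :
  word_state w s -> exec tape c w k s = Some (k', s') -> word_state w s'.
Proof.
elim: c w k s k' s' => [|x e|e1 e2|x|c1 IH1 c2 IH2|e c1 IH1 c2 IH2|e c IH|wc c IH x en ea et] w k s k' s' ws.
- by case: k => //= k [_ <-].
- case: k => //= k [_ <-]; split=> /=; last exact: ws.2.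
  by apply: word_upd; [exact: ws.1 | exact: word_eval].
- case: k => //= k [_ <-]; split=> /=; first exact: ws.1.
  by apply: word_upd; [exact: ws.2 | exact: word_eval].
- case: k => //= k [_ <-]; split=> /=; last exact: ws.2.
  by apply: word_upd; [exact: ws.1 | exact: ltn_pmod2X].
- rewrite /=; case E: (exec tape c1 w k s) => [[k1 s1]|//].
  by apply: IH2; apply: IH1 E.
- by case: k => //= k; case: ifP => _; [apply: IH1 | apply: IH2].
- rewrite exec_While; move: {1}k => r; elim: r k s ws => [|r IHr] [|k] s ws //=.
    by case: ifP => // _ [_ <-].
  case: ifP => [_|_ [_ <-]] //.
  case E: (exec tape c w k (tick 1 s)) => [[k1 s1]|//]; apply: IHr.
  exact: IH E.
- rewrite /=; case: ltnP => // _.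
  case: exec => [[b' s1]|].
    move=> [_ <-]; split=> i /=; last first.
      by rewrite /blit; case: ifP => _; [exact: ltn_pmod2X | exact: ws.2].
    by apply: word_upd; [exact: ws.1 | exact: ltn_pmod2X].
  case: ifP => // _ [_ <-]; split=> /=; last exact: ws.2.
  by apply: word_upd; [exact: ws.1 | rewrite expn_gt0].
Qed.

Definition answer_is (b : bool) (o : option (nat * state)) : bool :=
  if o is Some (_, s) then (memory s 0 != 0) == b else false.

Definition run_tree (P : procedure) n A k :=
  texec P.2 (word_bits P.1 n) k (init (word_bits P.1 n) n A 0).

Lemma run_texec (P : procedure) tape n A k :
  run P tape n A k = at_res (trun (run_tree P n A k) tape 0).
Proof. by rewrite /run_tree -exec_texec. Qed.

Lemma answer_is_at_res b o : answer_is b (at_res o) = answer_is b o.1.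
Proof. by case: o => -[[]|]. Qed.

Lemma card_answers (P : procedure) n (G : sgraph 'I_n) t b :
  (#|[set r : t.-tuple bool | answers P G t (nth false r) b]|%:R =
   2 ^+ t * pr (run_tree P n (adj_array G) t) (fun o => (answer_is b o)%:R) :> rat)%R.
Proof.
rewrite -(pr_count (answer_is b)) ?fueled_depth ?fueled_texec //.
congr (_%:R)%R; apply: eq_card => r; rewrite !inE /answers run_texec.
by rewrite -answer_is_at_res; case: at_res => [[]|].
Qed.

Lemma eq_run P tape n A k1 k2 s1 s2 k1' k2' :
  run P tape n A k1 = Some (k1', s1) -> run P tape n A k2 = Some (k2', s2) ->
  s1 = s2.
Proof.
by move=> /(exec_addfuel k2) e1 /(exec_addfuel k1); rewrite addnC e1 => -[_ ->].
Qed.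

Lemma run_le P tape n A k1 k2 :
  k1 <= k2 -> run P tape n A k1 <> None -> run P tape n A k2 <> None.
Proof.
move=> k12; case E: run => [[k s]|] // _.
by have := exec_addfuel (k2 - k1) E; rewrite subnKC // /run => ->.
Qed.

(** Correctness and the time bound supply different witnesses for the running time. All sufficient
    ones lead to the same final state, hence to the same success probability. *)
Lemma pr_run_halts P n (G : sgraph 'I_n) k1 k2 b :
  halts_within P G k1 -> halts_within P G k2 ->
  pr (run_tree P n (adj_array G) k1) (fun o => (answer_is b o)%:R)%R =
  pr (run_tree P n (adj_array G) k2) (fun o => (answer_is b o)%:R)%R.
Proof.
move=> h1 h2; apply: eq_pr_trun => tape; rewrite -!answer_is_at_res -!run_texec.
have := h1 tape; have := h2 tape.
case E1: run => [[k1' s1]|] //; case E2: run => [[k2' s2]|] // _ _.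
by rewrite /answer_is (eq_run E1 E2).
Qed.

(** * Programs with a decision tree as specification *)

Definition assertion := (nat -> nat) -> (nat -> nat) -> Prop.

(** Expressions read neither the position nor the ghost counter, so both are set to 0. *)
Definition ev w (r m : nat -> nat) e := eval w (State r m 0 0) e.

Lemma eval_ev w s e : eval w s e = ev w (regs s) (memory s) e.
Proof. by elim: e => //= [e ->|o e1 -> e2 ->]. Qed.

(** [T] bounds the total time and [O] the time outside calls. Assertions see
    neither the tape position nor the ghost counter. *)
Definition triple w (Pre : assertion) c Y (t : dtree Y) (Post : Y -> assertion)
    (T O : nat) : Prop :=
  forall tape s, Pre (regs s) (memory s) -> exists s',
    [/\ Post (trun t tape (pos s)).1 (regs s') (memory s'),
        pos s' = (trun t tape (pos s)).2, own s' <= own s + O &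
        forall k, T <= k -> exists k',
          exec tape c w k s = Some (k', s') /\ k <= k' + T].

Lemma triple_conseq w (Pre Pre' : assertion) c Y (t : dtree Y)
    (Post Post' : Y -> assertion) T T' O O' :
  triple w Pre c t Post T O ->
  (forall r m, Pre' r m -> Pre r m) ->
  (forall y r m, Post y r m -> Post' y r m) -> T <= T' -> O <= O' ->
  triple w Pre' c t Post' T' O'.
Proof.
move=> tr pre post TT OO tape s /pre /(tr tape)[s' [P p o e]].
exists s'; split=> //; [exact: post | lia | move=> k Tk].
by have [|k' [ek kk]] := e k; [lia | exists k'; split=> //; lia].
Qed.

Lemma triple_assign w (Pre : assertion) x e Y (y : Y) (Post : Y -> assertion) :
  (forall r m, Pre r m -> Post y (upd r x (ev w r m e)) m) ->
  triple w Pre (Assign x e) (Ret y) Post 1 1.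
Proof.
move=> H tape s /H P; exists (tick 1 (set_reg x (eval w s e) s)).
split=> //=; first by rewrite eval_ev.
by case=> // k _; exists k; split=> //; lia.
Qed.

Lemma triple_store w (Pre : assertion) e1 e2 Y (y : Y) (Post : Y -> assertion) :
  (forall r m, Pre r m -> Post y r (upd m (ev w r m e1) (ev w r m e2))) ->
  triple w Pre (Store e1 e2) (Ret y) Post 1 1.
Proof.
move=> H tape s /H P.
exists (tick 1 (State (regs s) (upd (memory s) (eval w s e1) (eval w s e2))
                      (pos s) (own s))).
split=> //=; first by rewrite !eval_ev.
by case=> // k _; exists k; split=> //; lia.
Qed.

Lemma triple_flip w (Pre : assertion) x (Post : bool -> assertion) :
  (forall b r m, Pre r m -> Post b (upd r x (b %% 2 ^ w)) m) ->
  triple w Pre (Flip x) (Coin (@Ret bool)) Post 1 1.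
Proof.
move=> H tape s /(H (tape (pos s))) P.
exists (tick 1 (State (upd (regs s) x (tape (pos s) %% 2 ^ w)) (memory s)
                      (pos s).+1 (own s))).
split=> //=.
by case=> // k _; exists k; split=> //; lia.
Qed.

Lemma triple_seq w (Pre : assertion) c1 c2 Y Z (t1 : dtree Y) (t2 : Y -> dtree Z)
    (Mid : Y -> assertion) (Post : Z -> assertion) T1 T2 O1 O2 :
  triple w Pre c1 t1 Mid T1 O1 ->
  (forall y, triple w (Mid y) c2 (t2 y) Post T2 O2) ->
  triple w Pre (Seq c1 c2) (tbind t1 t2) Post (T1 + T2) (O1 + O2).
Proof.
move=> tr1 tr2 tape s /(tr1 tape)[s1 [P1 p1 o1 e1]].
have [s2 [P2 p2 o2 e2]] := tr2 _ tape _ P1.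
exists s2; rewrite trun_bind [trun t1 _ _]surjective_pairing -p1; split=> //.
  lia.
move=> k Tk; have [|k1 [E1 kk1]] := e1 k; first lia.
have [|k2 [E2 kk2]] := e2 k1; first lia.
by exists k2; rewrite /= E1; split=> //; lia.
Qed.

Lemma loopS body w e r k s :
  loop body w e r.+1 k.+1 s =
  if eval w s e != 0 then
    if body k (tick 1 s) is Some (k2, s2) then loop body w e r k2 s2 else None
  else Some (k, tick 1 s).
Proof. by []. Qed.

Definition For x e c :=
  Seq (Assign x (Const 0)) (While (Bin OLt (Reg x) e) (Seq c (Assign x (Bin OAdd (Reg x) (Const 1))))).

(** A round costs its body, the test and the increment; the last [+ 2] pays for the initial
    assignment and the failing test. The body leaves the counter alone but establishes the invariant
    for its next value. *)
Lemma triple_for w x e c N Y (f : nat -> Y -> dtree Y) (y0 : Y)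
    (Pre : assertion) (Inv : nat -> Y -> assertion) T O :
  0 < w -> N < 2 ^ w ->
  (forall r m, Pre r m -> Inv 0 y0 (upd r x 0) m) ->
  (forall i y r m, i <= N -> Inv i y r m -> ev w r m e = N /\ r x = i) ->
  (forall i y, i < N ->
     triple w (Inv i y) c (f i y)
       (fun y' r m => Inv i.+1 y' (upd r x i.+1) m /\ r x = i) T O) ->
  triple w Pre (For x e c) (iterM f 0 N y0) (Inv N) (N * (T + 2) + 2)
    (N * (O + 2) + 2).
Proof.
move=> w0 Nw H0 HI Hc.
have w1 : 1 < 2 ^ w by rewrite (@leq_exp2l 2 1).
pose body := Seq c (Assign x (Bin OAdd (Reg x) (Const 1))).
have Hb i y : i < N -> triple w (Inv i y) body (f i y) (fun y' => Inv i.+1 y') (T + 1) (O + 1).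
  move=> iN tape s /(Hc i y iN tape)[s1 [[P1 x1] p1 o1 e1]].
  exists (tick 1 (set_reg x i.+1 s1)); split=> //=; first lia.
  move=> k Tk; have [|k1 [E1 kk1]] := e1 k; first lia.
  rewrite E1; case: k1 kk1 E1 => [|k1] kk1 E1; first lia.
  exists k1; rewrite x1 (@modn_small 1) // addn1 modn_small; last lia.
  by split=> //; lia.
pose e' := Bin OLt (Reg x) e.
suff HL r : forall i y, i + r = N -> forall tape s, Inv i y (regs s) (memory s) ->
  exists s', [/\ Inv N (trun (iterM f i r y) tape (pos s)).1 (regs s') (memory s'),
     pos s' = (trun (iterM f i r y) tape (pos s)).2,
     own s' <= own s + (r * (O + 2) + 1) &
     forall rounds k, r <= rounds -> r * (T + 2) + 1 <= k -> exists k',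
      loop (exec tape body w) w e' rounds k s = Some (k', s') /\
      k <= k' + (r * (T + 2) + 1)].
  move=> tape s Ps.
  have [s' [P p o E]] := HL N 0 y0 (add0n N) tape (tick 1 (set_reg x 0 s)) (H0 _ _ Ps).
  exists s'; split=> //; first by move: o => /=; lia.
  case=> [|k] Tk; first lia.
  have [||k' [Ek kk]] := E k k; [nia | lia |].
  by exists k'; rewrite -Ek /= mod0n; split=> //; lia.
elim: r => [|r IH] i y iN tape s Is.
  rewrite addn0 in iN; subst i.
  have [eN xN] := HI _ _ _ _ (leqnn N) Is.
  exists (tick 1 s); split=> //= rounds [|k] _ Tk; first lia.
  exists k; split; last lia.
  by case: rounds => [|rd] /=; rewrite eval_ev eN xN ltnn mod0n.
have iN' : i < N by lia.
have [eN xN] := HI _ _ _ _ (ltnW iN') Is.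
have [s1 [P1 p1 o1 E1]] := Hb i y iN' tape (tick 1 s) Is.
have iN2 : i.+1 + r = N by lia.
have [s2 [P2 p2 o2 E2]] := IH _ _ iN2 tape s1 P1.
exists s2; rewrite [iterM _ _ r.+1 _]/= trun_bind [trun (f i y) _ _]surjective_pairing.
rewrite /= in p1; rewrite -p1; split=> //.
  move: o1 => /=; lia.
case=> [|rounds] [|k] rr Tk; try lia; rewrite loopS.
have [|k1 [Ek1 kk1]] := E1 k; first lia.
have [||k2 [Ek2 kk2]] := E2 rounds k1; [lia|lia|].
rewrite Ek1; exists k2; split; last lia.
have e'N : eval w (s : state) e' != 0.
  by rewrite /= !eval_ev eN xN iN' modn_small.
by rewrite e'N.
Qed.

(** An interrupted call counts as the answer no, so the callee need not stop. *)
Definition call_tree wc c t n g : dtree bool :=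
  tbind (pad t (texec c (word_bits wc n) t (init (word_bits wc n) n g 0)))
    (fun o => Ret (answer_is true o)).

Lemma eq_init w n A B p : (forall i, i < n * n -> A i = B i) ->
  init w n A p = init w n B p.
Proof.
by move=> AB; rewrite /init; congr State; apply/funext => i; case: ifP => // /AB ->.
Qed.

(** Only the conjunction of flag and answer word is specified, since after an interruption the block
    at [a] still holds the input. The bound on the word size keeps a nonzero answer nonzero when it
    is copied back. *)
Lemma triple_call w wc c x en ea et n a t g (Pre : assertion)
    (Post : bool -> assertion) :
  0 < w -> 0 < n -> word_bits wc n <= w ->
  (forall r m, Pre r m ->
     [/\ ev w r m en = n, ev w r m ea = a, ev w r m et = t &
         forall i, i < n * n -> m (a + i) = g i]) ->
  (forall r m v m', Pre r m -> v <= 1 ->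
     (forall i, ~~ (a <= i < a + n * n) -> m' i = m i) ->
     Post ((v != 0) && (m' a != 0)) (upd r x v) m') ->
  triple w Pre (Call wc c x en ea et) (call_tree wc c t n g) Post
    (n * n + 1 + t) (n * n + 1).
Proof.
move=> w0 n0 ww HE HP tape s Ps; have [En Ea Et Eg] := HE _ _ Ps.
have w1 : 1 < 2 ^ w by rewrite (@leq_exp2l 2 1).
set w1' := word_bits wc n in ww *.
set st := init w1' n g (pos s).
have Est : init w1' n (fun i => memory s (a + i)) (pos s) = st by exact: eq_init.
have texecE : exec tape c w1' t st = at_res (trun (texec c w1' t (init w1' n g 0)) tape (pos s)).
  by rewrite -exec_texec.
rewrite /call_tree trun_bind trun_pad ?fueled_depth ?fueled_texec //.
case E: (trun _ _ _) texecE => [[[b' s1]|] p'] /= texecE; last first.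
  exists (State (upd (regs s) x 0) (memory s) (pos s + t) (own s + (n * n).+1)).
  split=> //=.
  - have -> : false = (0 != 0) && (memory s a != 0) by [].
    exact: (HP (regs s) (memory s)).
  - lia.
  move=> k Tk; rewrite !eval_ev En Ea Et ltnNge.
  case: leqP => [kn|]; first lia.
  have -> : minn t (k - (n * n).+1) = t by lia.
  rewrite Est texecE ifT; last lia.
  by exists (k - (n * n).+1 - t); split=> //; lia.
exists (State (upd (regs s) x (1 %% 2 ^ w)) (blit w n a (memory s1) (memory s)) p' (own s + (n * n).+1)).
have ms1 : memory s1 0 < 2 ^ w1'.
  by have [_] := word_exec (word_init _ _ _ _) texecE; apply.
split=> //=.
- have -> : (memory s1 0 != 0) == true = (1 %% 2 ^ w != 0) && (blit w n a (memory s1) (memory s) a != 0).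
    rewrite /blit leqnn subnn /= -{1}[a]addn0 ltn_add2l muln_gt0 n0 /= (@modn_small 1) //=.
    rewrite modn_small ?eqb_id //.
    by rewrite (leq_trans ms1) // leq_exp2l.
  apply: (HP (regs s) (memory s)) => //; first by rewrite (@modn_small 1).
  by move=> i; rewrite /blit => /negbTE ->.
- lia.
move=> k Tk; rewrite !eval_ev En Ea Et ltnNge.
case: leqP => [kn|]; first lia.
have -> : minn t (k - (n * n).+1) = t by lia.
rewrite Est texecE /=.
by exists (k - (n * n).+1 - (t - b')); split=> //; lia.
Qed.

(** * The reduction *)

Lemma tbindA X Y Z (t : dtree X) (f : X -> dtree Y) (g : Y -> dtree Z) :
  tbind (tbind t f) g = tbind t (fun x => tbind (f x) g).
Proof. by elim: t => //= h IH; congr Coin; apply/funext. Qed.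

Lemma ev_bin w r m o e1 e2 a b v :
  ev w r m e1 = a -> ev w r m e2 = b -> binop_sem o a b = v -> v < 2 ^ w ->
  ev w r m (Bin o e1 e2) = v.
Proof. by rewrite /ev /= => -> -> -> /modn_small. Qed.

Lemma ev_const w r m v : v < 2 ^ w -> ev w r m (Const v) = v.
Proof. exact: modn_small. Qed.

Lemma ev_reg w r m x : ev w r m (Reg x) = r x.
Proof. by []. Qed.

Lemma ev_peek w r m e a v : ev w r m e = a -> m a = v -> ev w r m (Peek e) = v.
Proof. by rewrite /ev /= => ->. Qed.

(** The base-[lam] digits of the round number enumerate the triples of levels. *)
Definition digit (lam x t : nat) : nat := iter x (fun q => q %/ lam) t %% lam.

(** A conjunction of [l] fair coins, true with probability [2 ^- l]. *)
Definition keep (l : nat) : dtree bool :=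
  iterM (fun _ b => Coin (fun c => Ret (b && c))) 0 l true.

Definition samp (n l : nat) (K : seq bool) : dtree (seq bool) :=
  iterM (fun _ ks => tbind (keep l) (fun b => Ret (rcons ks b))) 0 n K.

(** Vertex [i < 3 * n] is copy [i %/ n] of the vertex [i %% n]. *)
Definition part_edge (w n : nat) (A : nat -> nat) (K : seq bool) (i j : nat) : bool :=
  [&& nth false K i, nth false K j, i %/ n != j %/ n &
      0 < A (i %% n * n + j %% n) %% 2 ^ w].

Definition part_array w n A K (q : nat) : nat :=
  part_edge w n A K (q %/ (3 * n)) (q %% (3 * n)).

Definition vote_tree wc c T m thr g : dtree nat :=
  iterM (fun _ y => tbind (call_tree wc c T m g) (fun b => Ret (y + b))) 0 (2 * thr) 0.

Definition round_tree wc c T thr w n A (lam t : nat) : dtree bool :=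
  tbind (samp n (digit lam 0 t) [::]) (fun K1 =>
  tbind (samp n (digit lam 1 t) K1) (fun K2 =>
  tbind (samp n (digit lam 2 t) K2) (fun K3 =>
  tbind (vote_tree wc c T (3 * n) thr (part_array w n A K3)) (fun y => Ret (thr < y))))).

Definition main_tree wc c T thr w n A lam N : dtree bool :=
  iterM (fun t acc => tbind (round_tree wc c T thr w n A lam t)
                            (fun b => Ret (acc || b))) 0 N false.

(** Registers: 0 the size [n], 1 the number of levels, 2 the size [3 * n] of the
    blow-up, 3 its address, 4 the time limit, 5 the number of rounds, 6 the
    threshold of the vote, 7 the answer, 8 the round, 9 the level, 10 the vertex,
    11 the coin counter, 12 the kept bit, 13 the coin, 14 the number of votes, 15
    the vote counter, 16 the array index, 17 the flag of the call. The memory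
    holds the input, then the [3 * n] kept bits, then the array of the blow-up. *)
Definition sample_cmd (x : nat) : cmd :=
  Seq (Assign 9 (Bin OMod (iter x (fun e => Bin ODiv e (Reg 1)) (Reg 8)) (Reg 1)))
   (For 10 (Reg 0)
     (Seq (Assign 12 (Const 1))
     (Seq (For 11 (Reg 9) (Seq (Flip 13) (Assign 12 (Bin OMul (Reg 12) (Reg 13)))))
          (Store (Bin OAdd (Bin OMul (Reg 0) (Reg 0))
                           (Bin OAdd (Bin OMul (Const x) (Reg 0)) (Reg 10))) (Reg 12))))).

Definition kept_expr e := Peek (Bin OAdd (Bin OMul (Reg 0) (Reg 0)) e).

(** Boolean connectives on words: products are conjunctions, comparison with 0 is negation. *)
Definition edge_expr (i j : expr) : expr :=
  Bin OMul (Bin OMul (kept_expr i) (kept_expr j))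
    (Bin OMul (Bin OEq (Bin OEq (Bin ODiv i (Reg 0)) (Bin ODiv j (Reg 0))) (Const 0))
       (Bin OLt (Const 0) (Peek (Bin OAdd (Bin OMul (Bin OMod i (Reg 0)) (Reg 0))
                                          (Bin OMod j (Reg 0)))))).

Definition build_cmd : cmd :=
  For 16 (Bin OMul (Reg 2) (Reg 2))
    (Store (Bin OAdd (Reg 3) (Reg 16))
           (edge_expr (Bin ODiv (Reg 16) (Reg 2)) (Bin OMod (Reg 16) (Reg 2)))).

(** The array is rebuilt before each vote because a call that stops overwrites it. *)
Definition vote_cmd wc c : cmd :=
  Seq build_cmd
    (Seq (Call wc c 17 (Reg 2) (Reg 3) (Reg 4))
         (Assign 14 (Bin OAdd (Reg 14)
            (Bin OMul (Bin OLt (Const 0) (Reg 17)) (Bin OLt (Const 0) (Peek (Reg 3))))))).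

Definition round_cmd wc c : cmd :=
  Seq (sample_cmd 0) (Seq (sample_cmd 1) (Seq (sample_cmd 2)
    (Seq (Assign 14 (Const 0))
    (Seq (For 15 (Bin OMul (Const 2) (Reg 6)) (vote_cmd wc c))
         (Assign 7 (Bin OLt (Const 0) (Bin OAdd (Reg 7) (Bin OLt (Reg 6) (Reg 14))))))))).

(** * Correctness of sampling, voting and a whole round *)

Section Program.
(** The memory in use ends at [n * n + 3 * n + 9 * (n * n)], at most [13 * (n * n)], so [hw] makes
    every address a word. *)
Context (wc : nat) (c : cmd) (w n lam T thr N : nat) (A : nat -> nat).
Context (n0 : 0 < n) (lam0 : 0 < lam) (hw : 13 * (n * n) < 2 ^ w) (hT : T < 2 ^ w)
  (hN : N < 2 ^ w) (hlam : lam < 2 ^ w) (hthr : 2 * thr < 2 ^ w)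
  (hwc : word_bits wc (3 * n) <= w).

Lemma word_gt0 : 0 < w.
Proof. by move: hw n0; clear; case: w => // h; nia. Qed.

Lemma three_lt_word : 3 < 2 ^ w.
Proof. by move: hw n0; clear; nia. Qed.

Lemma bool_lt_word (b : bool) : b < 2 ^ w.
Proof. by move: three_lt_word; clear; case: b => /=; lia. Qed.

Definition base (r m : nat -> nat) : Prop :=
  [/\ r 0 = n, r 1 = lam, r 2 = 3 * n & r 3 = n * n + 3 * n] /\
  [/\ r 4 = T, r 5 = N, r 6 = thr & forall i, i < n * n -> m i = A i %% 2 ^ w].

Definition frame (t : nat) (acc : bool) (r m : nat -> nat) : Prop :=
  [/\ base r m, r 7 = acc & r 8 = t].

Lemma base_upd x v r m : 6 < x -> base r m -> base (upd r x v) m.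
Proof. by move=> x6 [[? ? ? ?] [? ? ? ?]]; rewrite /base /upd; do !case: eqP => ?; subst => //. Qed.

Lemma frame_upd t acc x v r m : 8 < x -> frame t acc r m -> frame t acc (upd r x v) m.
Proof.
move=> x8 [b ? ?]; split; first by apply: base_upd => //; lia.
  by rewrite /upd; case: eqP => // ?; subst.
by rewrite /upd; case: eqP => // ?; subst.
Qed.

Lemma frame_mem t acc r m m' : (forall i, i < n * n -> m' i = m i) ->
  frame t acc r m -> frame t acc r m'.
Proof.
move=> mm [[b [? ? ? M]] ? ?]; split=> //; split=> //; split=> // i ni.
by rewrite mm // M.
Qed.

Definition stored (K : seq bool) (m : nat -> nat) : Prop :=
  forall i, i < size K -> m (n * n + i) = nth false K i.

Lemma ev_digit x t r m : t < N -> r 8 = t -> r 1 = lam ->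
  ev w r m (Bin OMod (iter x (fun e => Bin ODiv e (Reg 1)) (Reg 8)) (Reg 1)) = digit lam x t.
Proof.
move=> tN r8 r1; apply: (@ev_bin _ _ _ _ _ _ (iter x (fun q => q %/ lam) t) lam) => //.
  suff [] : ev w r m (iter x (fun e => Bin ODiv e (Reg 1)) (Reg 8)) = iter x (fun q => q %/ lam) t
    /\ iter x (fun q => q %/ lam) t <= t by [].
  elim: x => [|x [IH le]] //=; split; last by rewrite (leq_trans (leq_div _ _)).
  apply: (ev_bin IH (r1 : ev w r m (Reg 1) = lam)) => //.
  by have := leq_div (iter x (fun q => q %/ lam) t) lam; lia.
by have := ltn_pmod (iter x (fun q => q %/ lam) t) lam0; rewrite -/(digit _ _ _); lia.
Qed.

Definition sample_steps := n * (lam * 4 + 6) + 3.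

Lemma triple_sample x t acc K0 : x < 3 -> t < N -> size K0 = x * n ->
  triple w (fun r m => frame t acc r m /\ stored K0 m) (sample_cmd x)
    (samp n (digit lam x t) K0)
    (fun K r m => [/\ frame t acc r m, stored K m & size K = x.+1 * n])
    sample_steps sample_steps.
Proof.
move=> x3 tN sK0; set l := digit lam x t.
have l_lam : l < lam by rewrite ltn_pmod.
(* [Inv] describes the state after [i] vertices of the part, [Jnv] after [j] coins of the current
   vertex, whose partial conjunction is in register 12. *)
pose Inv i ks r m := [/\ frame t acc r m, stored ks m, size ks = x * n + i,
   r 9 = l & r 10 = i].
pose Jnv i ks (j : nat) (b : bool) r m := [/\ Inv i ks r m, r 12 = b & r 11 = j].
apply: (@triple_conseq _ (fun r m => frame t acc r m /\ stored K0 m) _ _ _ _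
  (fun K r m => Inv n K r m) _ (1 + (n * (1 + (l * ((1 + 1) + 2) + 2 + 1) + 2) + 2)) _
   (1 + (n * (1 + (l * ((1 + 1) + 2) + 2 + 1) + 2) + 2)) _ _) => //; first last.
- rewrite /sample_steps; nia.
- rewrite /sample_steps; nia.
- by move=> K r m [F S sz _ _]; split=> //; rewrite sz; nia.
apply: (triple_seq (t1 := Ret tt) (t2 := fun=> samp n l K0)
   (Mid := fun _ r m => [/\ frame t acc r m, stored K0 m & r 9 = l])).
  apply: triple_assign => r m [F S].
  split; [exact: frame_upd | by [] |].
  by rewrite /upd eqxx; apply: ev_digit => //; case: F => [[[]]].
move=> _; apply: triple_for; [exact: word_gt0 | nia | | |].
- move=> r m [F S r9]; split; [exact: frame_upd | by [] | by rewrite addn0 | by [] | by []].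
- by move=> i y r m ni [[[[r0 _ _ _] _] _ _] _ _ _ r10].
move=> i ks ni.
apply: (triple_seq (t1 := Ret tt) (t2 := fun=> tbind (keep l) (fun b => Ret (rcons ks b)))
   (Mid := fun _ r m => Inv i ks r m /\ r 12 = true)).
  apply: triple_assign => r m [F S sz r9 r10]; split; last first.
    by rewrite /upd eqxx ev_const //; have := three_lt_word; lia.
  by split; first exact: frame_upd.
move=> _.
apply: (triple_seq (Mid := fun b => Jnv i ks l b)); last first.
  move=> b; apply: triple_store => r m [[F S sz r9 r10] r12 r11].
  have [[[r0 _ _ _] _] _ _] := F.
  have -> : ev w r m (Bin OAdd (Bin OMul (Reg 0) (Reg 0))
      (Bin OAdd (Bin OMul (Const x) (Reg 0)) (Reg 10))) = n * n + size ks.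
    apply: (@ev_bin _ _ _ _ _ _ (n * n) (size ks)) => //; last by nia.
      by apply: (@ev_bin _ _ _ _ _ _ n n) => //; nia.
    rewrite sz; apply: (@ev_bin _ _ _ _ _ _ (x * n) i) => //; last by nia.
    apply: (@ev_bin _ _ _ _ _ _ x n) => //; last by nia.
    by apply: ev_const; have := three_lt_word; lia.
  rewrite ev_reg r12; split; last by [].
  split.
  - apply: frame_upd => //; apply: frame_mem F => j nj.
    by rewrite /upd ifF //; apply/eqP; lia.
  - move=> j; rewrite size_rcons ltnS nth_rcons /upd eqn_add2l.
    by case: (ltngtP j (size ks)) => // js _; rewrite S.
  - by rewrite size_rcons sz addnS.
  - by [].
  - by rewrite /upd eqxx.
apply: triple_for; [exact: word_gt0 | lia | | |].
- by move=> r m [[F S sz r9 r10] r12]; split=> //; split=> //; exact: frame_upd.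
- by move=> j y r m lj [[F S sz r9 r10] r12 r11].
move=> j b lj.
apply: (triple_seq (t1 := Coin (@Ret bool)) (t2 := fun cc => Ret (b && cc))
  (Mid := fun cc r m => Jnv i ks j b r m /\ r 13 = cc)).
  apply: triple_flip => cc r m [[F S sz r9 r10] r12 r11].
  split; last by rewrite /upd eqxx modn_small // bool_lt_word.
  by split=> //; split=> //; exact: frame_upd.
move=> cc; apply: triple_assign => r m [[[F S sz r9 r10] r12 r11] r13].
have -> : ev w r m (Bin OMul (Reg 12) (Reg 13)) = b && cc.
  apply: (@ev_bin _ _ _ _ _ _ b cc) => //; last exact: bool_lt_word.
  by case: (b) (cc) => [] [].
split; last by [].
by split=> //; split=> //; exact: frame_upd.
Qed.


Lemma ev_kept t acc K r m e i : frame t acc r m -> stored K m -> size K = 3 * n ->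
  i < 3 * n -> ev w r m e = i -> ev w r m (kept_expr e) = nth false K i.
Proof.
move=> F S sK iK ei; have [[[r0 _ _ _] _] _ _] := F.
apply: (@ev_peek _ _ _ _ (n * n + i)); last by rewrite S ?sK.
apply: (@ev_bin _ _ _ _ _ _ (n * n) i) => //; last nia.
by apply: (@ev_bin _ _ _ _ _ _ n n) => //; nia.
Qed.

Lemma ev_edge t acc K r m ei ej i j : frame t acc r m -> stored K m ->
  size K = 3 * n -> i < 3 * n -> j < 3 * n -> ev w r m ei = i -> ev w r m ej = j ->
  ev w r m (edge_expr ei ej) = part_edge w n A K i j.
Proof.
move=> F S sK iK jK Ei Ej; have [[[r0 _ _ _] [_ _ _ M]] _ _] := F.
have im : i %% n < n by rewrite ltn_pmod.
have jm : j %% n < n by rewrite ltn_pmod.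
have h3 := three_lt_word.
apply: (@ev_bin _ _ _ _ _ _ (nth false K i && nth false K j)
  ((i %/ n != j %/ n) && (0 < A (i %% n * n + j %% n) %% 2 ^ w))).
- apply: (@ev_bin _ _ _ _ _ _ (nth false K i) (nth false K j)).
  + exact: (ev_kept F S sK iK Ei).
  + exact: (ev_kept F S sK jK Ej).
  + by rewrite /= mulnb.
  + exact: bool_lt_word.
- apply: (@ev_bin _ _ _ _ _ _ (i %/ n != j %/ n) (0 < A (i %% n * n + j %% n) %% 2 ^ w)).
  + apply: (@ev_bin _ _ _ _ _ _ (i %/ n == j %/ n) 0).
    * apply: (@ev_bin _ _ _ _ _ _ (i %/ n) (j %/ n)) => //; last exact: bool_lt_word.
        apply: (@ev_bin _ _ _ _ _ _ i n) => //.
        by have := leq_div i n; nia.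
      apply: (@ev_bin _ _ _ _ _ _ j n) => //.
      by have := leq_div j n; nia.
    * by apply: ev_const; lia.
    * by rewrite /= eqb0.
    * exact: bool_lt_word.
  + apply: (@ev_bin _ _ _ _ _ _ 0 (A (i %% n * n + j %% n) %% 2 ^ w)) => //.
    * by apply: ev_const; lia.
    * apply: (@ev_peek _ _ _ _ (i %% n * n + j %% n)); last by rewrite M //; nia.
      apply: (@ev_bin _ _ _ _ _ _ (i %% n * n) (j %% n)) => //; last nia.
        apply: (@ev_bin _ _ _ _ _ _ (i %% n) n) => //; last nia.
        by apply: (@ev_bin _ _ _ _ _ _ i n) => //; nia.
      by apply: (@ev_bin _ _ _ _ _ _ j n) => //; nia.
    * exact: bool_lt_word.
  + by rewrite /= mulnb.
  + exact: bool_lt_word.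
- by rewrite /= mulnb -andbA.
- exact: bool_lt_word.
Qed.

Definition voting t acc K v y (r m : nat -> nat) : Prop :=
  [/\ frame t acc r m, stored K m, r 14 = y & r 15 = v].

Lemma triple_build t acc K v y : size K = 3 * n ->
  triple w (voting t acc K v y) build_cmd (Ret tt)
    (fun _ r m => voting t acc K v y r m /\
       forall q, q < 3 * n * (3 * n) -> m (n * n + 3 * n + q) = part_array w n A K q)
    (27 * (n * n) + 2) (27 * (n * n) + 2).
Proof.
move=> sK; set M := 3 * n.
pose Inv i (_ : unit) r m := [/\ voting t acc K v y r m, r 16 = i &
  forall q, q < i -> m (n * n + 3 * n + q) = part_array w n A K q].
(* The loop flips no coins, so its iterated tree collapses to a leaf; the loop rule expects the
   iterated form. *)
have iterE i q : iterM (fun _ x => Ret x) i q tt = Ret tt by elim: q i => //= q IH i.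
rewrite -(iterE 0 (M * M)).
apply: (@triple_conseq _ (voting t acc K v y) _ _ _ _ (Inv (M * M)) _
  (M * M * (1 + 2) + 2) _ (M * M * (1 + 2) + 2)) => //; first last.
- rewrite /M; nia.
- rewrite /M; nia.
- by move=> _ r m [V _ H].
have mlt : M * M < 2 ^ w by rewrite /M; nia.
apply: triple_for => //.
- exact: word_gt0.
- move=> i _ r m ni [[[[[_ _ r2 _] _] _ _] _ _ _] r16 _]; split=> //.
  by apply: (@ev_bin _ _ _ _ _ _ M M).
move=> i [] ni; apply: triple_store => r m [V r16 H].
have [F S r14 r15] := V; have [[[r0 r1 r2 r3] _] _ _] := F.
have h3 := three_lt_word.
have iq : i %/ M < M by rewrite ltn_divLR // /M; lia.
have ir : i %% M < M by rewrite ltn_mod /M; lia.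
have -> : ev w r m (Bin OAdd (Reg 3) (Reg 16)) = n * n + 3 * n + i.
  by apply: (@ev_bin _ _ _ _ _ _ (n * n + 3 * n) i) => //; rewrite /M in ni; nia.
have -> : ev w r m (edge_expr (Bin ODiv (Reg 16) (Reg 2)) (Bin OMod (Reg 16) (Reg 2)))
    = part_array w n A K i.
  apply: (ev_edge F S) => //.
    by apply: (@ev_bin _ _ _ _ _ _ i M) => //; rewrite /M in iq *; nia.
  by apply: (@ev_bin _ _ _ _ _ _ i M) => //; rewrite /M in ir *; nia.
split; last by [].
split; last 1 first.
- move=> q; rewrite ltnS leq_eqVlt /upd eqn_add2l; case: eqP => [-> //|_] /= qi.
  exact: H.
- split.
  + apply: frame_upd => //; apply: frame_mem F => j nj.
    by rewrite /upd ifF //; apply/eqP; lia.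
  + move=> j jK; rewrite /upd ifF; first exact: S.
    by apply/eqP; rewrite sK in jK; lia.
  + by [].
  + by [].
- by rewrite /upd eqxx.
Qed.

Definition vote_own := 27 * (n * n) + 2 + (9 * (n * n) + 1 + 1).

(** The bounds [y <= v] and [v < 2 * thr] keep the tally at most [2 * thr], so adding a vote cannot
    overflow. *)
Lemma triple_vote t acc K v y : size K = 3 * n -> y <= v -> v < 2 * thr ->
  triple w (voting t acc K v y) (vote_cmd wc c)
    (tbind (call_tree wc c T (3 * n) (part_array w n A K)) (fun b => Ret (y + b)))
    (fun y' r m => voting t acc K v y' r m /\ y' <= y.+1) (vote_own + T) vote_own.
Proof.
move=> sK yv vthr; have h3 := three_lt_word.
set g := part_array w n A K; set M := 3 * n.
apply: (@triple_conseq _ (voting t acc K v y) _ _ _ _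
  (fun y' r m => voting t acc K v y' r m /\ y' <= y.+1) _
  (27 * (n * n) + 2 + (M * M + 1 + T + 1)) _ (27 * (n * n) + 2 + (M * M + 1 + 1))) => //;
  last 2 first.
- rewrite /vote_own /M; nia.
- rewrite /vote_own /M; nia.
apply: (triple_seq (t1 := Ret tt) (t2 := fun=> tbind _ _)); first exact: triple_build.
case; apply: (triple_seq
  (Mid := fun b r m => voting t acc K v y r m /\ (r 17 != 0) && (m (n * n + M) != 0) = b)).
  apply: (@triple_call _ _ _ _ _ _ _ _ (n * n + M)) => //.
  - exact: word_gt0.
  - by rewrite /M; lia.
  - by move=> r m [[F _ _ _] H]; have [[[r0 r1 r2 r3] [r4 r5 r6 _]] _ _] := F.
  - move=> r m u m' [[F S r14 r15] _] u1 mm; split; last by [].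
    split=> //.
    + apply: frame_upd => //; apply: frame_mem F => i ni; apply: mm.
      by rewrite negb_and; lia.
    + move=> i iK; rewrite mm; first exact: S.
      by rewrite negb_and; rewrite sK in iK; lia.
move=> b; apply: triple_assign => r m [[F S r14 r15] E].
have -> : ev w r m (Bin OAdd (Reg 14)
   (Bin OMul (Bin OLt (Const 0) (Reg 17)) (Bin OLt (Const 0) (Peek (Reg 3))))) = y + b.
  have [[[r0 r1 r2 r3] _] _ _] := F.
  apply: (@ev_bin _ _ _ _ _ _ y b) => //; last by have := leq_b1 b; lia.
  apply: (@ev_bin _ _ _ _ _ _ (0 < r 17) (0 < m (n * n + M))).
  - by apply: (@ev_bin _ _ _ _ _ _ 0 (r 17)) => //; [apply: ev_const; lia | exact: bool_lt_word].
  - apply: (@ev_bin _ _ _ _ _ _ 0 (m (n * n + M))) => //; [apply: ev_const; lia | | exact: bool_lt_word].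
    by apply: (@ev_peek _ _ _ _ (n * n + M)).
  - by rewrite /= mulnb -E !lt0n.
  - exact: bool_lt_word.
split; last by have := leq_b1 b; lia.
by split=> //; exact: frame_upd.
Qed.

Definition round_own := 3 * sample_steps + (2 * thr * (vote_own + 2) + 4).

Lemma triple_round t acc : t < N ->
  triple w (frame t acc) (round_cmd wc c)
    (tbind (round_tree wc c T thr w n A lam t) (fun b => Ret (acc || b)))
    (fun acc' r m => frame t acc' r m) (round_own + 2 * thr * T) round_own.
Proof.
move=> tN; have h3 := three_lt_word.
rewrite /round_tree.
apply: (@triple_conseq _ (frame t acc) _ _ _ _
  (fun acc' r m => frame t acc' r m) _
  (sample_steps + (sample_steps + (sample_steps + (1 + (2 * thr * (vote_own + T + 2) + 2 + 1))))) _
  (sample_steps + (sample_steps + (sample_steps + (1 + (2 * thr * (vote_own + 2) + 2 + 1)))))) => //;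
  last 2 first.
- rewrite /round_own; nia.
- rewrite /round_own; nia.
pose Mid x K r m := [/\ frame t acc r m, stored K m & size K = x * n].
have sampleP x K0 : x < 3 -> triple w (Mid x K0) (sample_cmd x) (samp n (digit lam x t) K0)
    (Mid x.+1) sample_steps sample_steps.
  move=> x3 tape s [F S sz]; have := @triple_sample x t acc K0 x3 tN sz.
  by move=> /(_ tape s (conj F S)).
(* The tree is reassociated stage by stage to match the right-nested sequence of commands. *)
rewrite tbindA; apply: (triple_seq (Mid := Mid 1)).
  apply: (triple_conseq (sampleP 0 [::] _)) => // r m F; split=> //.
move=> K1; rewrite tbindA; apply: triple_seq; first exact: sampleP.
move=> K2; rewrite tbindA; apply: triple_seq; first exact: sampleP.
move=> K; apply: (triple_seq (t1 := Ret tt) (t2 := fun=> tbind (tbind _ _) _)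
  (Mid := fun _ r m => Mid 3 K r m /\ r 14 = 0)).
  apply: triple_assign => r m [F S sz]; split; last by rewrite /upd eqxx ev_const //; lia.
  by split=> //; exact: frame_upd.
pose Vnv i y r m := [/\ voting t acc K i y r m, size K = 3 * n & y <= i].
case; rewrite tbindA; apply: (triple_seq (Mid := Vnv (2 * thr))).
  apply: triple_for.
  - exact: word_gt0.
  - by [].
  - move=> r m [[F S sz] r14]; split=> //; split=> //; exact: frame_upd.
  - move=> i y r m ni [[F S r14 r15] sK yi]; split=> //.
    have [_ [_ _ r6 _]] := let: And3 b _ _ := F in b.
    apply: (@ev_bin _ _ _ _ _ _ 2 thr) => //; apply: ev_const; lia.
  - move=> i y ni tape s [V sK yi].
    have [s' [[V' yy] p o e]] := @triple_vote t acc K i y sK yi ni tape s V.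
    exists s'; split=> //.
    have [F S r14 r15] := V'; split=> //; split=> //; last lia.
move=> y; apply: triple_assign => r m [[[B r7 r8] S r14 _] _ y2].
have -> : ev w r m (Bin OLt (Const 0) (Bin OAdd (Reg 7) (Bin OLt (Reg 6) (Reg 14)))) = acc || (thr < y).
  have [_ [_ _ r6 _]] := B.
  apply: (@ev_bin _ _ _ _ _ _ 0 (acc + (thr < y))).
  - by apply: ev_const; lia.
  - apply: (@ev_bin _ _ _ _ _ _ acc (thr < y)) => //.
      by apply: (@ev_bin _ _ _ _ _ _ thr y) => //; exact: bool_lt_word.
    by case: (acc) (thr < y) => [] []; lia.
  - by case: (acc) (thr < y) => [] [].
  - exact: bool_lt_word.
by split=> //; exact: base_upd.
Qed.

End Program.

(** * Parameters, set-up and the complete program *)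

(** Isolating a vertex in a set of size [s <= n] uses level [trunc_log 2 s + 2]. *)
Definition levels (n : nat) : nat := trunc_log 2 n + 3.
(** An integer upper bound for [C * (3 * n) ^ (3 - 2 / p)]: with [e = levels n %/ p + 1], [3 * n] is
    below [2 ^ (p * e)], whose power [(3 * p - 2) / p] is again a power of 2, computed by a
    shift. *)
Definition time_limit (C p n : nat) : nat := C * 2 ^ ((levels n %/ p + 1) * (3 * p - 2)).
(** Each triple of levels occurs 2048 times. If there is a triangle, the isolation probabilities
    over all triples add up to at least [1 / 512] and a vote keeps at least half, so the acceptance
    probabilities of the rounds add up to at least 2. *)
Definition rounds (n : nat) : nat := 2048 * (levels n * (levels n * levels n)).
(** Makes the error of a vote at most [2 ^- (16 * levels n)], small enough for a union bound over
    the rounds. *)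
Definition threshold (n : nat) : nat := 96 * levels n.

(** Register 1 starts at 2 and counts the [i < n] with [2 ^ i <= n]; there are [trunc_log 2 n + 1]
    of them, which makes [levels n]. *)
Definition setup_cmd (C p : nat) : cmd :=
  Seq (Seq (Assign 1 (Const 2))
    (For 8 (Reg 0)
       (Assign 1 (Bin OAdd (Reg 1) (Bin OLt (Const 0) (Bin OShr (Reg 0) (Reg 8)))))))
  (Seq (Assign 2 (Bin OMul (Const 3) (Reg 0)))
  (Seq (Assign 3 (Bin OAdd (Bin OMul (Reg 0) (Reg 0)) (Reg 2)))
  (Seq (Assign 4 (Bin OShl (Const C)
          (Bin OMul (Bin OAdd (Bin ODiv (Reg 1) (Const p)) (Const 1)) (Const (3 * p - 2)))))
  (Seq (Assign 5 (Bin OMul (Const 2048) (Bin OMul (Reg 1) (Bin OMul (Reg 1) (Reg 1)))))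
  (Seq (Assign 6 (Bin OMul (Const 96) (Reg 1)))
       (Assign 7 (Const 0))))))).

(** In the word constant, [3 * P.1] makes room for the words of calls of size [3 * n], [C] and
    [3 * p] for the time limit, 100 for addresses and counters. *)
Definition reduction (P : procedure) (C p : nat) : procedure :=
  (C + 3 * p + 100 + 3 * P.1,
   Seq (setup_cmd C p)
     (Seq (For 8 (Reg 5) (round_cmd P.1 P.2)) (Store (Const 0) (Reg 7)))).

Definition reduction_tree (P : procedure) C p n A : dtree bool :=
  main_tree P.1 P.2 (time_limit C p n) (threshold n) (word_bits (reduction P C p).1 n)
    n A (levels n) (rounds n).

Lemma ltn_levels n : 4 * n < 2 ^ levels n.
Proof.
have := trunc_log_ltn n (isT : 1 < 2); rewrite /levels addn3 !expnS; lia.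
Qed.

Section Bounds.
Context (P : procedure) (C p n : nat) (n0 : 0 < n) (p0 : 0 < p).
Let w := word_bits (reduction P C p).1 n.

(** Turns overflow checks into comparisons of exponents that are linear in the logarithm of [n]. *)
Lemma exp_lt_word x : x <= 100 * (trunc_log 2 n).+1 + C + 3 * p -> 2 ^ x <= 2 ^ w.
Proof. by move=> xl; rewrite leq_exp2l // /w /word_bits /=; nia. Qed.

Lemma levels_lt : levels n < 2 ^ w.
Proof.
apply: (leq_trans (ltn_expl (levels n) (isT : 1 < 2))).
by apply: exp_lt_word; rewrite /levels; lia.
Qed.

Lemma rounds_lt : rounds n < 2 ^ w.
Proof.
apply: (@leq_trans (2 ^ (11 + 3 * levels n))); last by apply: exp_lt_word; rewrite /levels; lia.
have := ltn_expl (levels n) (isT : 1 < 2).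
rewrite expnD (mulnC 3) expnM /rounds -[2048]/(2 ^ 11) ltn_pmul2l ?expn_gt0 // => h.
by rewrite !expnS expn0 muln1 !ltn_mul.
Qed.

Lemma threshold_lt : 2 * threshold n < 2 ^ w.
Proof.
apply: leq_trans rounds_lt; rewrite /threshold /rounds /levels; nia.
Qed.

Lemma square_lt : 13 * (n * n) < 2 ^ w.
Proof.
apply: (@leq_trans (2 ^ (2 * levels n))); last by apply: exp_lt_word; rewrite /levels; lia.
by rewrite (mulnC 2) expnM -mulnn; have := ltn_mul (ltn_levels n) (ltn_levels n); nia.
Qed.

Lemma exponent_le : (levels n %/ p + 1) * (3 * p - 2) <= 3 * levels n + 3 * p.
Proof. by move: (leq_divM (levels n) p) p0; clear; nia. Qed.

Lemma time_limit_lt : time_limit C p n < 2 ^ w.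
Proof.
apply: (@leq_trans (2 ^ (C + (3 * levels n + 3 * p)))); last by apply: exp_lt_word; rewrite /levels; lia.
rewrite expnD /time_limit; have := ltn_expl C (isT : 1 < 2).
have : 2 ^ ((levels n %/ p + 1) * (3 * p - 2)) <= 2 ^ (3 * levels n + 3 * p).
  by rewrite leq_exp2l // exponent_le.
have : 0 < 2 ^ (3 * levels n + 3 * p) by rewrite expn_gt0.
nia.
Qed.

Lemma const_lt x : x <= 100 + C + 3 * p -> x < 2 ^ w.
Proof.
move=> xl; apply: (leq_trans (ltn_expl x (isT : 1 < 2))).
by apply: exp_lt_word; lia.
Qed.

Lemma word_bits_le : word_bits P.1 (3 * n) <= w.
Proof.
have h : trunc_log 2 (3 * n) < levels n.
  rewrite -(@ltn_exp2l 2) //; apply: leq_ltn_trans (ltn_levels n).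
  apply: (@leq_trans (3 * n)); last lia.
  by apply: trunc_logP; lia.
by rewrite /w /word_bits /=; rewrite /levels in h; nia.
Qed.

End Bounds.

Section Main.
Context (P : procedure) (C p n : nat) (A : nat -> nat) (n0 : 0 < n) (p0 : 0 < p).
Let w := word_bits (reduction P C p).1 n.
Let lam := levels n.
Let T := time_limit C p n.
Let thr := threshold n.
Let N := rounds n.

Let initial (r m : nat -> nat) :=
  [/\ r 0 = n & forall i, i < n * n -> m i = A i %% 2 ^ w].

Lemma triple_levels :
  triple w initial
    (Seq (Assign 1 (Const 2))
       (For 8 (Reg 0)
          (Assign 1 (Bin OAdd (Reg 1) (Bin OLt (Const 0) (Bin OShr (Reg 0) (Reg 8)))))))
    (Ret tt) (fun _ r m => initial r m /\ r 1 = lam) (3 * n + 3) (3 * n + 3).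
Proof.
have sq := square_lt P C n0 p0; have cl := @const_lt P C p n n0 p0; rewrite -/w in sq cl.
apply: (@triple_conseq _ initial _ _ _ _ (fun _ r m => initial r m /\ r 1 = lam) _
  (1 + (n * (1 + 2) + 2)) _ (1 + (n * (1 + 2) + 2))) => //; last 2 first.
- lia.
- lia.
apply: (triple_seq (t1 := Ret tt) (t2 := fun=> Ret tt)
  (Mid := fun _ r m => initial r m /\ r 1 = 2)).
  apply: triple_assign => r m [r0 M]; split; last by rewrite /upd eqxx ev_const // cl //; lia.
  by split.
case.
have iterE i q : iterM (fun _ x => Ret x) i q tt = Ret tt by elim: q i => //= q IH i.
rewrite -(iterE 0 n).
pose Inv i (_ : unit) r m := [/\ initial r m, r 8 = i & r 1 = 2 + minn i (trunc_log 2 n).+1].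
have tl : trunc_log 2 n < n.
  apply: (leq_trans (ltn_expl _ (isT : 1 < 2))); exact: trunc_logP.
apply: (@triple_conseq _ (fun r m => initial r m /\ r 1 = 2) _ _ _ _ (Inv n) _
  (n * (1 + 2) + 2) _ (n * (1 + 2) + 2)) => //; last first.
  by move=> _ r m [I _ r1]; split=> //; rewrite r1 /lam /levels; lia.
apply: triple_for.
- exact: (word_gt0 n0 sq).
- nia.
- by move=> r m [[r0 M] r1]; split=> //; rewrite min0n addn0.
- by move=> i _ r m ni [[r0 M] r8 r1].
move=> i [] ni; apply: triple_assign => r m [[r0 M] r8 r1].
split; last by [].
split=> //.
rewrite /upd /=.
apply: (@ev_bin _ _ _ _ _ _ (r 1) (2 ^ i <= n)) => //.
- apply: (@ev_bin _ _ _ _ _ _ 0 (n %/ 2 ^ i)) => //.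
  + by apply: ev_const; apply: cl.
  + apply: (@ev_bin _ _ _ _ _ _ n i) => //.
    by have := leq_div n (2 ^ i); nia.
  + by rewrite /= divn_gt0 ?expn_gt0.
  + by apply: bool_lt_word n0 sq _.
- rewrite /= r1; case: (leqP (2 ^ i) n) => h.
    by have := trunc_log_max (isT : 1 < 2) h; lia.
  have : trunc_log 2 n < i; last lia.
  by rewrite -(@ltn_exp2l 2) // (leq_ltn_trans _ h) // trunc_logP.
- have : minn i.+1 (trunc_log 2 n).+1 <= n by lia.
  nia.
Qed.


Lemma triple_setup :
  triple w initial (setup_cmd C p) (Ret tt)
    (fun _ r m => base w n lam T thr N A r m /\ r 7 = false) (3 * n + 9) (3 * n + 9).
Proof.
have sq := square_lt P C n0 p0; have cl := @const_lt P C p n n0 p0.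
have ll := levels_lt P C n0 p0; have Nl := rounds_lt P C n0 p0.
have tl := threshold_lt P C n0 p0; have Tl := time_limit_lt P C n0 p0.
rewrite -/w in sq cl ll Nl tl Tl.
have lam3 : 3 <= lam by rewrite /lam /levels; lia.
have lam2 : lam * lam < 2 ^ w /\ lam * (lam * lam) < 2 ^ w.
  by move: Nl lam3; rewrite /N /rounds -/lam; clear; nia.
have cE r m x : x <= 100 + C + 3 * p -> ev w r m (Const x) = x.
  by move=> h; apply: ev_const; apply: cl.
apply: (@triple_conseq _ initial _ _ _ _
   (fun _ r m => base w n lam T thr N A r m /\ r 7 = false) _
   (3 * n + 3 + (1 + (1 + (1 + (1 + (1 + 1)))))) _
   (3 * n + 3 + (1 + (1 + (1 + (1 + (1 + 1))))))) => //; last 2 first.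
- lia.
- lia.
apply: (triple_seq (t1 := Ret tt) (t2 := fun=> Ret tt)); first exact: triple_levels.
case; apply: (triple_seq (t1 := Ret tt) (t2 := fun=> Ret tt)
  (Mid := fun _ r m => [/\ initial r m, r 1 = lam & r 2 = 3 * n])).
  apply: triple_assign => r m [[r0 M] r1].
  have -> : ev w r m (Bin OMul (Const 3) (Reg 0)) = 3 * n.
    apply: (@ev_bin _ _ _ _ _ _ 3 n) => //; first by apply: cE; lia.
    by move: sq n0; clear; nia.
  by split.
case; apply: (triple_seq (t1 := Ret tt) (t2 := fun=> Ret tt)
  (Mid := fun _ r m => [/\ initial r m, r 1 = lam, r 2 = 3 * n & r 3 = n * n + 3 * n])).
  apply: triple_assign => r m [[r0 M] r1 r2].
  have -> : ev w r m (Bin OAdd (Bin OMul (Reg 0) (Reg 0)) (Reg 2)) = n * n + 3 * n.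
    apply: (@ev_bin _ _ _ _ _ _ (n * n) (3 * n)) => //.
      by apply: (@ev_bin _ _ _ _ _ _ n n) => //; lia.
    by move: sq n0; clear; nia.
  by split.
case; apply: (triple_seq (t1 := Ret tt) (t2 := fun=> Ret tt)
  (Mid := fun _ r m => [/\ initial r m, r 1 = lam, r 2 = 3 * n & r 3 = n * n + 3 * n] /\ r 4 = T)).
  apply: triple_assign => r m [[r0 M] r1 r2 r3].
  have -> : ev w r m (Bin OShl (Const C) (Bin OMul
      (Bin OAdd (Bin ODiv (Reg 1) (Const p)) (Const 1)) (Const (3 * p - 2)))) = T.
    apply: (@ev_bin _ _ _ _ _ _ C ((lam %/ p + 1) * (3 * p - 2))) => //.
      by apply: cE; lia.
    apply: (@ev_bin _ _ _ _ _ _ (lam %/ p + 1) (3 * p - 2)) => //.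
    - apply: (@ev_bin _ _ _ _ _ _ (lam %/ p) 1) => //.
      + apply: (@ev_bin _ _ _ _ _ _ lam p) => //; first by apply: cE; lia.
        by have := leq_div lam p; lia.
      + by apply: cE; lia.
      + by have := leq_div lam p; move: lam2 lam3; clear; nia.
    - by apply: cE; lia.
    - apply: (leq_ltn_trans (exponent_le n p0)).
      have : 3 * lam + 3 * p < 2 ^ (3 * lam + 3 * p) by apply: ltn_expl.
      move=> h; apply: (leq_trans h); apply: exp_lt_word => //.
      by rewrite /lam /levels; lia.
  by split.
case; apply: (triple_seq (t1 := Ret tt) (t2 := fun=> Ret tt)
  (Mid := fun _ r m => [/\ initial r m, r 1 = lam, r 2 = 3 * n & r 3 = n * n + 3 * n] /\
     r 4 = T /\ r 5 = N)).
  apply: triple_assign => r m [[[r0 M] r1 r2 r3] r4].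
  have -> : ev w r m (Bin OMul (Const 2048) (Bin OMul (Reg 1) (Bin OMul (Reg 1) (Reg 1)))) = N.
    apply: (@ev_bin _ _ _ _ _ _ 2048 (lam * (lam * lam))) => //.
      apply: ev_const; move: Nl lam3; rewrite /N /rounds -/lam; clear; nia.
    apply: (@ev_bin _ _ _ _ _ _ lam (lam * lam)) => //; last by case: lam2.
    by apply: (@ev_bin _ _ _ _ _ _ lam lam) => //; case: lam2.
  by split.
case; apply: (triple_seq (t1 := Ret tt) (t2 := fun=> Ret tt)
  (Mid := fun _ r m => [/\ initial r m, r 1 = lam, r 2 = 3 * n & r 3 = n * n + 3 * n] /\
     [/\ r 4 = T, r 5 = N & r 6 = thr])).
  apply: triple_assign => r m [[[r0 M] r1 r2 r3] [r4 r5]].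
  have -> : ev w r m (Bin OMul (Const 96) (Reg 1)) = thr.
    apply: (@ev_bin _ _ _ _ _ _ 96 lam) => //; first by apply: cE; lia.
    lia.
  by split.
case; apply: triple_assign => r m [[[r0 M] r1 r2 r3] [r4 r5 r6]].
by rewrite cE.
Qed.

Definition reduction_own n := 3 * n + 9 + (rounds n * (round_own n (levels n) (threshold n) + 2) + 3).

Definition reduction_steps n :=
  reduction_own n + rounds n * (2 * threshold n * time_limit C p n).

Lemma triple_reduction :
  triple w initial (reduction P C p).2 (reduction_tree P C p n A)
    (fun b _ m => m 0 = b) (reduction_steps n) (reduction_own n).
Proof.
have sq := square_lt P C n0 p0; have cl := @const_lt P C p n n0 p0.
have ll := levels_lt P C n0 p0; have Nl := rounds_lt P C n0 p0.
have tl := threshold_lt P C n0 p0; have Tl := time_limit_lt P C n0 p0.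
have wl := word_bits_le P C n0 p0.
rewrite -/w in sq cl ll Nl tl Tl wl.
have lam0 : 0 < lam by rewrite /lam /levels; lia.
(* A trailing trivial bind, to be matched with the final [Store]. *)
have bE : reduction_tree P C p n A = tbind (reduction_tree P C p n A) (@Ret bool).
  by elim: reduction_tree => //= g IH; congr Coin; apply/funext.
set ro := round_own n lam thr.
apply: (@triple_conseq _ initial _ _ _ _ (fun (b : bool) _ m => m 0 = b) _
  (3 * n + 9 + ((N * (ro + 2 * thr * T + 2) + 2) + 1)) _ (3 * n + 9 + ((N * (ro + 2) + 2) + 1))) => //; last 2 first.
- rewrite /reduction_steps /reduction_own -/lam -/T -/thr -/N -/ro; lia.
- rewrite /reduction_own -/lam -/T -/thr -/N -/ro; lia.
rewrite bE; apply: (triple_seq (t1 := Ret tt) (t2 := fun=> tbind _ _)); first exact: triple_setup.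
case; apply: (triple_seq (Mid := fun b r m => frame w n lam T thr N A N b r m)).
  apply: triple_for.
  - exact: (word_gt0 n0 sq).
  - by [].
  - by move=> r m [B r7]; split=> //; exact: base_upd.
  - by move=> i y r m ni [[[r0 r1 r2 r3] [r4 r5 r6 _]] r7 r8].
  move=> i y ni.
  apply: (triple_conseq (@triple_round P.1 P.2 w n lam T thr N A n0 lam0 sq Tl Nl ll tl wl i y ni)) => //.
  by move=> b r m [B r7 r8]; split=> //; split=> //; exact: base_upd.
move=> b; apply: triple_store => r m [_ r7 _].
by rewrite ev_const ?expn_gt0 // ev_reg r7.
Qed.
End Main.

Lemma reduction_run P C p n A tape : 0 < n -> 0 < p ->
  exists s, [/\ memory s 0 = (trun (reduction_tree P C p n A) tape 0).1 :> nat,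
    own s <= reduction_own n &
    forall k, reduction_steps C p n <= k ->
      exists k', run (reduction P C p) tape n A k = Some (k', s)].
Proof.
move=> n0 p0; set w := word_bits (reduction P C p).1 n.
have [|s [m0 _ o E]] := @triple_reduction P C p n A n0 p0 tape (init w n A 0).
  split=> [|i ni] /=; last by rewrite ni.
  rewrite /upd /= modn_small //.
  by have := square_lt P C n0 p0; rewrite -/w; nia.
exists s; split=> // k /E[k' [Ek _]]; by exists k'.
Qed.

(** * Isolating a triangle *)

Local Open Scope ring_scope.

Lemma pr_ge0 X (t : dtree X) f : (forall x, 0 <= f x) -> 0 <= pr t f.
Proof. by move=> f0; rewrite -(pr_cst t 0); exact: ler_pr. Qed.

Lemma pr_le1 X (t : dtree X) (f : X -> bool) : pr t (fun x => (f x)%:R) <= 1.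
Proof. by rewrite -[leRHS](pr_cst t); apply: ler_pr => x; rewrite lern1 leq_b1. Qed.

Lemma pr_bool (t : dtree bool) f :
  pr t f = pr t (fun b => b%:R) * f true + (1 - pr t (fun b => b%:R)) * f false.
Proof.
elim: t => [b|g IH] /=; first by case: b => /=; lra.
rewrite (IH true) (IH false); lra.
Qed.

(** * Majority votes *)

Section Vote.
Context (t : dtree bool).
Let y := pr t (fun b => b%:R).
Let votes r c := iterM (fun _ c => tbind t (fun b => Ret (c + b)%N)) 0 r c.

(** The number of new votes is binomial, and this is its generating function, shifted by the [c]
    votes already counted. *)
Lemma pr_votes z i r c :
  pr (iterM (fun _ c => tbind t (fun b => Ret (c + b)%N)) i r c) (fun c => z ^+ c) =
  z ^+ c * (1 - y + z * y) ^+ r.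
Proof.
elim: r i c => [|r IH] i c /=; first by rewrite expr0 mulr1.
rewrite !pr_bind pr_bool /= !IH -/y addn1 addn0 !exprS; lra.
Qed.

Lemma expr_sqr_half (a b : rat) n : a ^+ (2 * n) * b ^+ n = (a ^+ 2 * b) ^+ n.
Proof. by rewrite exprMn -exprM. Qed.

(** Markov's inequality for [2 ^ c], where [c] is the number of votes. *)
Lemma pr_votes_high n : y <= 1 / 3%:R ->
  pr (votes (2 * n) 0) (fun c => (n < c)%:R) <= (8%:R / 9%:R) ^+ n.
Proof.
move=> y3; have y0 : 0 <= y by apply: pr_ge0 => b; exact: ler0n.
apply: (@le_trans _ _ (2%:R^-1 ^+ n * pr (votes (2 * n) 0) (fun c => 2%:R ^+ c))).
  rewrite -prZ; apply: ler_pr => c.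
  have p2 k : 0 < 2%:R ^+ k :> rat by rewrite exprn_gt0.
  case: ltnP => nc; last by rewrite mulr_ge0 ?exprn_ge0 ?invr_ge0 ?ler0n.
  rewrite exprVn mulrC ler_pdivlMr // mul1r.
  by rewrite ler_eXn2l // ?ltr1n // ltnW.
rewrite pr_votes expr0 mul1r mulrC expr_sqr_half.
(* At [z = 2] the base is [(1 + y) ^ 2 / 2], which is [8 / 9] at [y = 1 / 3]. *)
apply: lerXn2r; rewrite ?nnegrE; nra.
Qed.

(** Markov's inequality for [2 ^ - c]. *)
Lemma pr_votes_low n : 2%:R / 3%:R <= y ->
  pr (votes (2 * n) 0) (fun c => (~~ (n < c)%N)%:R) <= (8%:R / 9%:R) ^+ n.
Proof.
move=> y3; have y1 : y <= 1 by apply: (pr_le1 t id).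
apply: (@le_trans _ _ (2%:R ^+ n * pr (votes (2 * n) 0) (fun c => 2%:R^-1 ^+ c))).
  rewrite -prZ; apply: ler_pr => c.
  have p2 k : 0 < 2%:R ^+ k :> rat by rewrite exprn_gt0.
  rewrite -leqNgt; case: leqP => nc; last by rewrite mulr_ge0 ?exprn_ge0 ?invr_ge0 ?ler0n.
  rewrite exprVn ler_pdivlMr // mul1r.
  by rewrite ler_eXn2l // ltr1n.
rewrite pr_votes expr0 mul1r mulrC expr_sqr_half.
(* At [z = 1 / 2] the base is [2 * (1 - y / 2) ^ 2], which is [8 / 9] at [y = 2 / 3]. *)
apply: lerXn2r; rewrite ?nnegrE; nra.
Qed.
End Vote.

(** * Random samples of one part *)

Lemma pr_keep l f : pr (keep l) f = 2%:R^-1 ^+ l * f true + (1 - 2%:R^-1 ^+ l) * f false.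
Proof.
rewrite /keep.
have F i r : pr (iterM (fun _ b => Coin (fun c => Ret (b && c))) i r false) f = f false.
  by elim: r i => //= r IH i; rewrite !IH; lra.
suff H i : pr (iterM (fun _ b => Coin (fun c => Ret (b && c))) i l true) f =
    2%:R^-1 ^+ l * f true + (1 - 2%:R^-1 ^+ l) * f false by apply: H.
elim: l i => [|l IH] i /=; first by rewrite expr0; lra.
by rewrite IH F exprS; lra.
Qed.


Definition grow (l : nat) (ks : seq bool) : dtree (seq bool) :=
  tbind (keep l) (fun b => Ret (rcons ks b)).

Lemma pr_samp_cat n l K g : pr (samp n l K) g = pr (samp n l [::]) (fun s => g (K ++ s)).
Proof.
suff H i j s : pr (iterM (fun=> grow l) i n (K ++ s)) g =
    pr (iterM (fun=> grow l) j n s) (fun s => g (K ++ s)).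
  by have := H 0%N 0%N [::]; rewrite cats0.
elim: n i j s => [|n IH] i j s //=.
rewrite !pr_bind; apply: eq_pr => b /=; rewrite rcons_cat; exact: IH.
Qed.

(** [samp] appends at the end, whereas sums over vertices split at the first one; this provides the
    matching recursion. *)
Lemma pr_sampS n l g : pr (samp n.+1 l [::]) g =
  pr (keep l) (fun b => pr (samp n l [::]) (fun s => g (b :: s))).
Proof.
rewrite /samp /= !pr_bind; apply: eq_pr => b /=.
transitivity (pr (samp n l [:: b]) g); last exact: pr_samp_cat.
suff H i j s : pr (iterM (fun=> grow l) i n s) g = pr (iterM (fun=> grow l) j n s) g.
  exact: H.
elim: n i j s => [|n IH] i j s //=.
by rewrite !pr_bind; apply: eq_pr => c /=; apply: IH.
Qed.

Definition hits (S : nat -> bool) (n : nat) (ks : seq bool) : nat :=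
  \sum_(i < n) (S i && nth false ks i).

Definition mass (S : nat -> bool) (n : nat) : nat := \sum_(i < n) S i.

Lemma hits_cons S n b ks :
  hits S n.+1 (b :: ks) = ((S 0 && b) + hits (fun i => S i.+1) n ks)%N.
Proof. by rewrite /hits big_ord_recl. Qed.

Lemma massS S n : mass S n.+1 = (S 0%N + mass (fun i => S i.+1) n)%N.
Proof. by rewrite /mass big_ord_recl. Qed.

Lemma pr_hits0 S n l :
  pr (samp n l [::]) (fun ks => (hits S n ks == 0%N)%:R) = (1 - 2%:R^-1 ^+ l) ^+ mass S n.
Proof.
elim: n S => [|n IH] S; first by rewrite /= /hits /mass !big_ord0 expr0.
rewrite pr_sampS pr_keep massS.
under eq_pr => ks do rewrite hits_cons andbT addn_eq0.
under [in X in _ + X]eq_pr => ks do rewrite hits_cons andbF add0n.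
rewrite IH; case: (S 0%N) => /=.
  by rewrite pr_cst mulr0 add0r add1n exprS.
by rewrite IH add0n; lra.
Qed.

(** A binomial probability. If the first vertex is in [S] and kept, the remaining ones must give no
    hit, which is [pr_hits0]. *)
Lemma pr_hits1 S n l (q := 2%:R^-1 ^+ l) :
  pr (samp n l [::]) (fun ks => (hits S n ks == 1%N)%:R) =
  (mass S n)%:R * q * (1 - q) ^+ (mass S n).-1.
Proof.
elim: n S => [|n IH] S; first by rewrite /= /hits /mass !big_ord0 !mul0r.
rewrite pr_sampS pr_keep massS -/q.
under eq_pr => ks do rewrite hits_cons andbT.
under [in X in _ + X]eq_pr => ks do rewrite hits_cons andbF add0n.
rewrite IH; case: (S 0%N) => /=; last by rewrite IH add0n; lra.
under eq_pr => ks do rewrite add1n eqSS.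
rewrite pr_hits0 -/q add1n; set S' := fun i => _.
case: (mass S' n) => [|s] /=; first by rewrite expr0 !mul0r; lra.
rewrite exprS -[in RHS]natr1; lra.
Qed.

Lemma bernoulli_ge (q : rat) s : 0 <= q <= 1 -> 1 - s%:R * q <= (1 - q) ^+ s.
Proof.
move=> /andP[q0 q1]; elim: s => [|s IH]; first by rewrite mul0r subr0 expr0.
rewrite exprS; apply: (@le_trans _ _ ((1 - q) * (1 - s%:R * q))).
  have : 0 <= s%:R * q * q by rewrite !mulr_ge0.
  rewrite -natr1; lra.
by rewrite ler_wpM2l // subr_ge0.
Qed.

(** For a set of size [s], level [trunc_log 2 s + 2] puts [s * q] between [1 / 4] and [1 / 2], so
    that [s * q * (1 - q) ^ (s - 1)] is at least [1 / 4 * 1 / 2]. The program does not know [s],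
    hence the sum over all levels. *)
Lemma isolate S n : (0 < mass S n)%N ->
  8%:R^-1 <= \sum_(l < trunc_log 2 n + 3)
    pr (samp n l [::]) (fun ks => (hits S n ks == 1%N)%:R).
Proof.
move=> s0; set s := mass S n in s0.
have sn : (s <= n)%N.
  rewrite /s /mass -[leqRHS]card_ord -sum1_card; apply: leq_sum => i _; exact: leq_b1.
have lt : (trunc_log 2 s + 2 < trunc_log 2 n + 3)%N.
  by have := leq_trunc_log 2 sn; lia.
rewrite (bigD1 (Ordinal lt)) //= -[leLHS]addr0; apply: lerD; last first.
  by apply: sumr_ge0 => l _; apply: pr_ge0 => ks; exact: ler0n.
rewrite pr_hits1 -/s /=; set q : rat := _ ^+ _.
have p2 k : 0 < 2%:R ^+ k :> rat by rewrite exprn_gt0 ?ltr0n.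
have lo : (2 ^ trunc_log 2 s <= s)%N by apply: trunc_logP.
have hi : (s < 2 ^ (trunc_log 2 s).+1)%N by apply: trunc_log_ltn.
have qE : q * 2%:R ^+ trunc_log 2 s = 4%:R^-1.
  rewrite /q exprVn exprD invfM mulrC mulrA mulfV ?mul1r // gt_eqF //.
have q0 : 0 <= q by rewrite exprn_ge0 ?invr_ge0 ?ler0n.
have sq1 : 4%:R^-1 <= s%:R * q.
  by rewrite -qE mulrC ler_wpM2r // -natrX ler_nat.
have sq2 : s%:R * q <= 2%:R^-1.
  apply: (@le_trans _ _ (2%:R ^+ (trunc_log 2 s).+1 * q)).
    by rewrite ler_wpM2r // -natrX ler_nat ltnW.
  by rewrite exprS; lra.
have s1 : 1 <= s%:R :> rat by rewrite ler1n.
have q1 : q <= 1 by nra.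
have : 2%:R^-1 <= (1 - q) ^+ s.-1.
  apply: le_trans (bernoulli_ge s.-1 _); last by rewrite q0.
  have : (s.-1)%:R * q <= s%:R * q by rewrite ler_wpM2r // ler_nat leq_pred.
  lra.
by move=> h; apply: le_trans (ler_pM _ _ sq1 h); lra.
Qed.

(** Chains isolations: a bound [a] that holds once a vertex is isolated survives with a loss of a
    factor 8. *)
Lemma isolate_bound S n g (a : rat) : (0 < mass S n)%N ->
  (forall ks, 0 <= g ks) -> 0 <= a ->
  (forall ks, hits S n ks = 1%N -> a <= g ks) ->
  a / 8%:R <= \sum_(l < trunc_log 2 n + 3) pr (samp n l [::]) g.
Proof.
move=> S0 g0 a0 ag; apply: (le_trans (ler_wpM2l a0 (isolate S0))).
rewrite mulr_sumr; apply: ler_sum => l _; rewrite -prZ; apply: ler_pr => ks.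
by case: eqP => [/ag|]; rewrite ?mulr1 ?mulr0.
Qed.

Definition chosen (S : nat -> bool) (n : nat) (ks : seq bool) : nat :=
  find (fun i => S i && nth false ks i) (iota 0 n).

(** The three parts are isolated one after the other because triangles that
    share an edge survive the sampling in a correlated way. *)
Section Isolation.
Context (n : nat) (tri : nat -> nat -> nat -> bool).

Definition below (S : nat -> bool) : bool := has S (iota 0 n).
Definition cand1 a := below (fun b => below (tri a b)).
Definition cand2 a b := below (tri a b).

Definition isolated (ka kb kc : seq bool) : bool :=
  let a := chosen cand1 n ka in
  let b := chosen (cand2 a) n kb in
  [&& hits cand1 n ka == 1, hits (cand2 a) n kb == 1 & hits (tri a b) n kc == 1]%N.

Lemma below_mass S : below S -> (0 < mass S n)%N.
Proof.
case/hasP => i; rewrite mem_iota add0n /= => ni Si.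
by rewrite /mass (bigD1 (Ordinal ni)) //= Si.
Qed.

Lemma chosenP S ks : hits S n ks = 1%N ->
  [/\ (chosen S n ks < n)%N, S (chosen S n ks), nth false ks (chosen S n ks) &
    forall i, (i < n)%N -> S i -> nth false ks i -> i = chosen S n ks].
Proof.
move=> h; set P := fun i => S i && nth false ks i.
have hP : has P (iota 0 n).
  apply/negPn/negP => /hasPn nP; move: h; rewrite /hits big1 // => i _.
  by apply/eqP; rewrite eqb0; apply: nP; rewrite mem_iota /=.
have cn : (chosen S n ks < n)%N by rewrite -[X in (_ < X)%N](size_iota 0 n) -has_find.
have := nth_find 0%N hP; rewrite -/(chosen S n ks) nth_iota // add0n => /andP[Sc kc].
split=> // i ni Si ki; apply/eqP/negPn/negP => ic.
move: h; rewrite /hits (bigD1 (Ordinal cn)) //= Sc kc (bigD1 (Ordinal ni)) /= ?Si ?ki //.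
Qed.

Let lam := (trunc_log 2 n + 3)%N.

(** Three isolations lose a factor 8 each. A member of one candidate set is by definition a vertex
    for which the next candidate set is nonempty. *)
Lemma isolated_prob (a b c : nat) : (a < n)%N -> (b < n)%N -> (c < n)%N -> tri a b c ->
  512%:R^-1 <= \sum_(i < lam) \sum_(j < lam) \sum_(k < lam)
    pr (samp n i [::]) (fun ka => pr (samp n j [::]) (fun kb =>
      pr (samp n k [::]) (fun kc => (isolated ka kb kc)%:R))).
Proof.
move=> an bn cn tabc.
have belowI (S : nat -> bool) i : (i < n)%N -> S i -> below S.
  by move=> ni Si; apply/hasP; exists i; rewrite ?mem_iota.
have -> : 512%:R^-1 = 64%:R^-1 / 8%:R :> rat by lra.
(* The inner sums over levels move inside the expectations over earlier parts, so that isolation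
   applies from the outside in. *)
under eq_bigr => i _ do (under eq_bigr => j _ do rewrite -pr_sum; rewrite -pr_sum).
apply: (@isolate_bound cand1).
- by apply: below_mass; apply: (belowI _ a) => //; apply: (belowI _ b) => //; apply: (belowI _ c).
- move=> ka; do 2 apply: sumr_ge0 => ? _.
  by apply: pr_ge0 => kb; apply: pr_ge0 => kc; exact: ler0n.
- by rewrite invr_ge0 ler0n.
move=> ka h1; have [a'n Sa' _ _] := chosenP h1; rewrite /isolated h1 eqxx /=.
have -> : 64%:R^-1 = 8%:R^-1 / 8%:R :> rat by lra.
set a' := chosen cand1 n ka in a'n Sa' *.
under eq_bigr => j _ do rewrite -pr_sum.
apply: (@isolate_bound (cand2 a')).
- by apply: below_mass; case/hasP: Sa' => b'; rewrite mem_iota /= => b'n; apply: belowI.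
- by move=> kb; apply: sumr_ge0 => k _; apply: pr_ge0 => kc; exact: ler0n.
- by rewrite invr_ge0 ler0n.
move=> kb h2; have [b'n Sb' _ _] := chosenP h2; rewrite h2 eqxx /=.
by apply: isolate; exact: below_mass.
Qed.
End Isolation.

(** * Combining the rounds *)

(** Allows comparisons valid only at leaves that occur: sampled lists have length [n], which the
    layout of the three parts relies on. *)
Fixpoint on_leaves X (Q : X -> Prop) (t : dtree X) : Prop :=
  match t with
  | Ret x => Q x
  | Coin g => on_leaves Q (g true) /\ on_leaves Q (g false)
  end.

Lemma ler_pr_leaves X (Q : X -> Prop) (t : dtree X) f g :
  on_leaves Q t -> (forall x, Q x -> f x <= g x) -> pr t f <= pr t g.
Proof.
move=> + fg; elim: t => [x /fg //|h IH] /= [hT hF].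
by rewrite ler_wpM2r ?invr_ge0 ?ler0n // lerD ?IH.
Qed.

Lemma on_leaves_bind X Y (Q : X -> Prop) (Q' : Y -> Prop) t (f : X -> dtree Y) :
  on_leaves Q t -> (forall x, Q x -> on_leaves Q' (f x)) -> on_leaves Q' (tbind t f).
Proof.
move=> + Qf; elim: t => [x /Qf //|h IH] /= [hT hF]; split; exact: IH.
Qed.

Lemma on_leavesT X (t : dtree X) : on_leaves xpredT t.
Proof. by elim: t => //= h IH; split. Qed.

Lemma size_samp n l : on_leaves (fun s => size s = n) (samp n l [::]).
Proof.
suff H i s : on_leaves (fun s' => size s' = size s + n)%N (iterM (fun=> grow l) i n s).
  exact: H.
elim: n i s => [|n IH] i s /=; first by rewrite addn0.
apply: (on_leaves_bind (Q := fun s' => size s' = (size s).+1)).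
  apply: (on_leaves_bind (on_leavesT _)) => b _ /=; exact: size_rcons.
by move=> s' ss; have := IH i.+1 s'; rewrite ss addSnnS.
Qed.

(** The rounds use separate coins, so their rejection probabilities multiply. *)
Lemma pr_any (f : nat -> dtree bool) i r acc :
  pr (iterM (fun t acc => tbind (f t) (fun b => Ret (acc || b))) i r acc)
     (fun b => (~~ b)%:R) =
  (~~ acc)%:R * \prod_(t < r) (1 - pr (f (i + t)%N) (fun b => b%:R)).
Proof.
elim: r i acc => [|r IH] i acc; first by rewrite big_ord0 mulr1.
rewrite /= !pr_bind pr_bool /= !IH big_ord_recl addn0 orbT mul0r mulr0 add0r orbF.
under [X in _ = _ * (_ * X)]eq_bigr => t _ do rewrite lift0 -addSnnS.
by rewrite mulrCA.
Qed.

(** The union bound, for inputs without triangle. *)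
Lemma prod_subr_ge (x : nat -> rat) r : (forall t, 0 <= x t <= 1) ->
  1 - \sum_(t < r) x t <= \prod_(t < r) (1 - x t).
Proof.
move=> x01; elim: r => [|r IH]; first by rewrite !big_ord0 subr0.
rewrite !big_ord_recr /=; have /andP[x0 x1] := x01 r.
have : 0 <= \sum_(t < r) x t by apply: sumr_ge0 => t _; case/andP: (x01 t).
move: IH; set S := \sum_(t < r) _; set Pi := \prod_(t < r) _ => IH S0.
have : (1 - S) * (1 - x r) <= Pi * (1 - x r) by rewrite ler_wpM2r // subr_ge0.
have : 0 <= S * x r by rewrite mulr_ge0.
lra.
Qed.

(** By induction from [(1 + S + x) * (1 - x) <= 1 + S]. Once the sum reaches 2, the product is at
    most [1 / 3]. *)
Lemma prod_subr_le (x : nat -> rat) r : (forall t, 0 <= x t <= 1) ->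
  (1 + \sum_(t < r) x t) * \prod_(t < r) (1 - x t) <= 1.
Proof.
move=> x01; elim: r => [|r IH]; first by rewrite !big_ord0 addr0 mulr1.
rewrite !big_ord_recr /=; have /andP[x0 x1] := x01 r.
have : 0 <= \sum_(t < r) x t by apply: sumr_ge0 => t _; case/andP: (x01 t).
have : 0 <= \prod_(t < r) (1 - x t).
  by apply: prodr_ge0 => t _; rewrite subr_ge0; case/andP: (x01 t).
move: IH; set S := \sum_(t < r) _; set Pi := \prod_(t < r) _ => IH Pi0 S0.
have : 0 <= Pi * (S * x r + x r * x r) by rewrite mulr_ge0 // addr_ge0 // mulr_ge0.
lra.
Qed.

Lemma sum_divmod (F : nat -> nat -> rat) a d : (0 < d)%N ->
  \sum_(t < a * d) F (t %% d)%N (t %/ d)%N = \sum_(q < a) \sum_(r < d) F r q.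
Proof.
move=> d0; elim: a => [|a IH]; first by rewrite mul0n !big_ord0.
rewrite big_ord_recr /= -IH mulSnr big_split_ord /=; congr (_ + _).
by apply: eq_bigr => r _; rewrite modnMDl divnMDl // modn_small // divn_small // addn0.
Qed.

(** Division with remainder three times; the last quotient does not enter [F] and yields the factor
    [c]. *)
Lemma sum_digits (F : nat -> nat -> nat -> rat) c d : (0 < d)%N ->
  \sum_(t < c * (d * (d * d))) F (digit d 0 t) (digit d 1 t) (digit d 2 t) =
  c%:R * \sum_(i < d) \sum_(j < d) \sum_(k < d) F i j k.
Proof.
move=> d0; rewrite !mulnA /digit /=.
rewrite (sum_divmod (fun i q => F i (q %% d) (q %/ d %% d))%N) // exchange_big /=.
rewrite mulr_sumr; apply: eq_bigr => i _.
rewrite (sum_divmod (fun j q => F i j (q %% d))%N) // exchange_big /= mulr_sumr.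
apply: eq_bigr => j _.
rewrite (sum_divmod (fun k q => F i j k)) // exchange_big /= mulr_sumr.
by apply: eq_bigr => k _; rewrite sumr_const card_ord mulr_natl.
Qed.

Local Close Scope ring_scope.

(** * Blow-ups *)

Lemma triangleP (V : finType) (G : sgraph V) (S : {set V}) :
  reflect (exists x y z, [/\ G x y, G x z, G y z & S = [set x; y; z]])
          (S \in triangles G).
Proof.
have neq a b : G a b -> a != b by apply: contraTneq => ->; rewrite (adj_irr G).
apply: (iffP idP) => [|[x [y [z [xy xz yz ->]]]]].
  rewrite inE => /andP[/eqP S3 /forall_inP adjS].
  have G_in a b : a \in S -> b \in S -> a != b -> G a b.
    by move=> aS bS ab; have /forall_inP/(_ b bS)/implyP := adjS a aS; apply.
  have /card_gt0P[x xS] : 0 < #|S| by rewrite S3.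
  have S2 : #|S :\ x| = 2 by have := cardsD1 x S; rewrite xS S3; lia.
  have /card_gt0P[y yS] : 0 < #|S :\ x| by rewrite S2.
  have S1 : #|S :\ x :\ y| = 1 by have := cardsD1 y (S :\ x); rewrite yS S2; lia.
  have /cards1P[z Sz] : #|S :\ x :\ y| == 1 by rewrite S1.
  have : z \in S :\ x :\ y by rewrite Sz set11.
  move: yS; rewrite !inE => /andP[yx yS] /and3P[zy zx zS].
  exists x, y, z; split; try by apply: G_in => //; rewrite eq_sym.
  apply/setP => u; rewrite !inE.
  have := congr1 (fun B : {set V} => u \in B) Sz; rewrite !inE.
  case: (eqVneq u y) => [->|uy] /=; first by rewrite yS orbT.
  by case: (eqVneq u x) => [->|ux] /=; first by rewrite xS.
rewrite inE setUC cardsU1 cards2 !inE ![z == _]eq_sym (negbTE (neq _ _ xz)).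
rewrite (negbTE (neq _ _ yz)) (neq _ _ xy) /=.
apply/forall_inP => a aS; apply/forall_inP => b bS; apply/implyP => ab.
move: aS bS ab; rewrite !inE.
by move=> /or3P[]/eqP-> /or3P[]/eqP->; rewrite ?eqxx // => _; rewrite // adj_sym.
Qed.

Lemma has_triangleP (V : finType) (G : sgraph V) :
  reflect (exists x y z, [/\ G x y, G x z & G y z]) (has_triangle G).
Proof.
apply: (iffP card_gt0P) => [[S /triangleP[x [y [z [xy xz yz _]]]]]|[x [y [z [xy xz yz]]]]].
  by exists x, y, z.
by exists [set x; y; z]; apply/triangleP; exists x, y, z.
Qed.

Lemma leq_card_triangles (V W : finType) (H : sgraph V) (G : sgraph W) phi :
  injective phi -> (forall x y, H x y -> G (phi x) (phi y)) ->
  #|triangles H| <= #|triangles G|.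
Proof.
move=> phi_inj hom.
rewrite -(card_imset (mem (triangles H)) (imset_inj phi_inj)).
apply/subset_leq_card/subsetP => _ /imsetP[_ /triangleP[x [y [z [xy xz yz ->]]]] ->].
apply/triangleP; exists (phi x), (phi y), (phi z); split; try exact: hom.
by rewrite !imsetU !imset_set1.
Qed.

(** An embedding pulls the three parts back to a 3-coloring of [H] and, being injective, sends
    distinct triangles to distinct triangles. *)
Lemma H_free_of (V W : finType) (H : sgraph V) (G : sgraph W) (part : W -> 'I_3) :
  ~ colorable 3 H \/ 1 < #|triangles H| ->
  (forall x y, G x y -> part x != part y) -> #|triangles G| <= 1 -> H_free H G.
Proof.
move=> hH Gpart G1 [phi [phi_inj hom]]; case: hH => [|H2].
  by apply; exists (part \o phi) => x y /hom/Gpart.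
by have := leq_card_triangles phi_inj hom; lia.
Qed.

Lemma adj_arrayE m (G : sgraph 'I_m) (i j : 'I_m) : adj_array G (i * m + j) = G i j.
Proof.
rewrite /adj_array; congr nat_of_bool.
apply/existsP/idP => [[i' /existsP[j' /andP[/eqP e Gij]]]|Gij]; last first.
  by exists i; apply/existsP; exists j; rewrite eqxx.
have m0 : 0 < m by apply: leq_ltn_trans (ltn_ord i).
have := congr1 (divn^~ m) e; rewrite /= !divnMDl // !divn_small // !addn0 => /val_inj ->.
by have := congr1 (modn^~ m) e; rewrite /= !modnMDl !modn_small // => /val_inj ->.
Qed.

Section Blowup.
Context (n : nat) (n0 : 0 < n) (G : sgraph 'I_n).

Definition vertex (i : nat) : 'I_n := Ordinal (ltn_pmod i n0).

Lemma vertexE (i : 'I_n) : vertex i = i.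
Proof. by apply: val_inj; rewrite /= modn_small. Qed.

Lemma vertex_mod i : vertex (i %% n) = vertex i.
Proof. by apply: val_inj; rewrite /= modn_mod. Qed.

Definition blowup_adj (K : seq bool) (i j : 'I_(3 * n)) : bool :=
  [&& nth false K i, nth false K j, i %/ n != j %/ n & G (vertex i) (vertex j)].

Lemma blowup_sym K : symmetric (blowup_adj K).
Proof.
move=> i j; rewrite /blowup_adj (eq_sym (i %/ n)) adj_sym.
by rewrite andbCA.
Qed.

Lemma blowup_irr K : irreflexive (blowup_adj K).
Proof. by move=> i; rewrite /blowup_adj eqxx !andbF. Qed.

Definition blowup K : sgraph 'I_(3 * n) := SGraph (@blowup_sym K) (@blowup_irr K).

Lemma part_lt (i : 'I_(3 * n)) : i %/ n < 3.
Proof. by rewrite ltn_divLR. Qed.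

Definition part (i : 'I_(3 * n)) : 'I_3 := Ordinal (part_lt i).

Lemma blowup_part K i j : blowup K i j -> part i != part j.
Proof. by case/and4P => _ _ ij _; rewrite -val_eqE. Qed.

Lemma part_array_blowup w K q : 0 < w -> q < 3 * n * (3 * n) ->
  part_array w n (adj_array G) K q = adj_array (blowup K) q.
Proof.
move=> w0 qlt; have m0 : 0 < 3 * n by rewrite muln_gt0.
have qd : q %/ (3 * n) < 3 * n by rewrite ltn_divLR.
have qm : q %% (3 * n) < 3 * n by rewrite ltn_mod.
rewrite {2}(divn_eq q (3 * n)).
rewrite (adj_arrayE (blowup K) (Ordinal qd) (Ordinal qm)).
rewrite /part_array /part_edge /= /blowup_adj /=.
have := adj_arrayE G (vertex (q %/ (3 * n))) (vertex (q %% (3 * n))).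
rewrite /= => ->; congr (nat_of_bool [&& _, _, _ & _]).
have w1 : 1 < 2 ^ w by rewrite (@leq_exp2l 2 1).
by case: (adj G _ _); rewrite ?mod0n // modn_small.
Qed.

Definition tri (a b c : nat) : bool :=
  [&& G (vertex a) (vertex b), G (vertex a) (vertex c) & G (vertex b) (vertex c)].

Lemma has_triangle_tri : has_triangle G ->
  exists a b c, [/\ a < n, b < n, c < n & tri a b c].
Proof.
case/has_triangleP => x [y [z [xy xz yz]]]; exists x, y, z; split=> //.
by rewrite /tri !vertexE xy xz yz.
Qed.

Lemma blowup_triangle K : has_triangle (blowup K) -> has_triangle G.
Proof.
case/has_triangleP => x [y [z [/and4P[_ _ _ xy] /and4P[_ _ _ xz] /and4P[_ _ _ yz]]]].
by apply/has_triangleP; exists (vertex x), (vertex y), (vertex z).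
Qed.

(** Edges join different parts, so a triangle meets each of the three parts once; sorting its
    vertices by part leaves six cases. *)
Lemma blowup_triangle_parts K S : S \in triangles (blowup K) ->
  exists x y z : 'I_(3 * n), [/\ S = [set x; y; z],
    [/\ x %/ n = 0, y %/ n = 1 & z %/ n = 2],
    [/\ nth false K x, nth false K y & nth false K z] & tri x y z].
Proof.
case/triangleP => x [y [z [/and4P[kx ky xyn xy] /and4P[_ kz xzn xz] /and4P[_ _ yzn yz] ->]]].
have sym a b : G (vertex a) (vertex b) = G (vertex b) (vertex a) by rewrite adj_sym.
have := part_lt x; have := part_lt y; have := part_lt z.
have perm3 (a b c : 'I_(3 * n)) : [set x; y; z] = [set a; b; c] ->
   a %/ n = 0 -> b %/ n = 1 -> c %/ n = 2 ->
   [&& nth false K a, nth false K b, nth false K c & tri a b c] ->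
   exists x0 y0 z0 : 'I_(3 * n), [/\ [set x; y; z] = [set x0; y0; z0],
    [/\ x0 %/ n = 0, y0 %/ n = 1 & z0 %/ n = 2],
    [/\ nth false K x0, nth false K y0 & nth false K z0] & tri x0 y0 z0].
  by move=> e pa pb pc /and4P[ka kb kc t]; exists a, b, c.
have yx : G (vertex y) (vertex x) by rewrite sym.
have zx : G (vertex z) (vertex x) by rewrite sym.
have zy : G (vertex z) (vertex y) by rewrite sym.
move=> hz hy hx.
have : (x %/ n = 0 /\ y %/ n = 1 /\ z %/ n = 2) \/ (x %/ n = 0 /\ z %/ n = 1 /\ y %/ n = 2) \/
       (y %/ n = 0 /\ x %/ n = 1 /\ z %/ n = 2) \/ (y %/ n = 0 /\ z %/ n = 1 /\ x %/ n = 2) \/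
       (z %/ n = 0 /\ x %/ n = 1 /\ y %/ n = 2) \/ (z %/ n = 0 /\ y %/ n = 1 /\ x %/ n = 2).
  by move: xyn xzn yzn hx hy hz; clear; move: (x %/ n) (y %/ n) (z %/ n); lia.
by case=> [[? [? ?]]|[[? [? ?]]|[[? [? ?]]|[[? [? ?]]|[[? [? ?]]|[? [? ?]]]]]]];
  [apply: (perm3 x y z)|apply: (perm3 x z y)|apply: (perm3 y x z)
  |apply: (perm3 y z x)|apply: (perm3 z x y)|apply: (perm3 z y x)] => //;
  rewrite ?kx ?ky ?kz ?/tri ?xy ?xz ?yz ?yx ?zx ?zy //;
  apply/setP => u; rewrite !inE; case: (u == x); case: (u == y); case: (u == z).
Qed.

Lemma belowI (S : nat -> bool) i : i < n -> S i -> below n S.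
Proof. by move=> ni Si; apply/hasP; exists i; rewrite ?mem_iota. Qed.

Lemma tri_mod a b c : tri (a %% n) (b %% n) (c %% n) = tri a b c.
Proof. by rewrite /tri !vertex_mod. Qed.

Context (ka kb kc : seq bool) (sa : size ka = n) (sb : size kb = n) (sc : size kc = n).
Let K := (ka ++ kb) ++ kc.

Lemma nth_part (i : nat) : i < 3 * n ->
  nth false K i = nth false (nth [::] [:: ka; kb; kc] (i %/ n)) (i %% n).
Proof.
move=> i3; have id3 : i %/ n < 3 by rewrite ltn_divLR.
have im : i %% n < n by rewrite ltn_mod.
rewrite {1}(divn_eq i n) /K !nth_cat size_cat sa sb.
case: (i %/ n) id3 => [|[|[|//]]] _ /=.
- by rewrite mul0n add0n im ltn_addr.
- rewrite mul1n ltn_add2l im ifF; last by apply/negbTE; rewrite -leqNgt leq_addr.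
  by rewrite addKn.
- rewrite ifF; last by apply/negbTE; rewrite -leqNgt; lia.
  by congr nth; lia.
Qed.

Context (iso : isolated n tri ka kb kc).

Lemma isolated_has_triangle : has_triangle (blowup K).
Proof.
case/and3P: iso => /eqP h1 /eqP h2 /eqP h3.
have [an _ aK _] := chosenP h1; have [bn _ bK _] := chosenP h2.
have [cn t cK _] := chosenP h3.
move: an bn cn t aK bK cK {h1 h2 h3}; set a := chosen _ _ ka; set b := chosen _ _ kb; set c := chosen _ _ kc.
move=> an bn cn /and3P[tab tac tbc] aK bK cK.
have xn : a < 3 * n by lia.
have yn : n + b < 3 * n by lia.
have zn : 2 * n + c < 3 * n by lia.
have x1 : a %/ n = 0 by rewrite divn_small.
have x2 : a %% n = a by rewrite modn_small.
have y1 : (n + b) %/ n = 1 by rewrite -{1}(mul1n n) divnMDl // divn_small.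
have y2 : (n + b) %% n = b by rewrite modnDl modn_small.
have z1 : (2 * n + c) %/ n = 2 by rewrite divnMDl // divn_small.
have z2 : (2 * n + c) %% n = c by rewrite modnMDl modn_small.
apply/has_triangleP; exists (Ordinal xn), (Ordinal yn), (Ordinal zn).
rewrite /= /blowup_adj /= !nth_part // x1 x2 y1 y2 z1 z2 /= aK bK cK /=.
by rewrite -(vertex_mod a) -(vertex_mod (n + b)) -(vertex_mod (2 * n + c)) x2 y2 z2.
Qed.

(** The vertex of a triangle in part 0 is a candidate, hence the chosen one; then its vertex in part
    1 is a candidate for that choice, and so on. *)
Lemma isolated_card_triangles : #|triangles (blowup K)| <= 1.
Proof.
case/and3P: iso => /eqP h1 /eqP h2 /eqP h3.
have [_ _ _ u1] := chosenP h1; have [_ _ _ u2] := chosenP h2.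
have [_ _ _ u3] := chosenP h3.
(* Every triangle is one explicit set, given by the chosen residue in each part. *)
suff H S : S \in triangles (blowup K) -> S = [set i : 'I_(3 * n) |
    (i %% n) == nth 0 [:: chosen (cand1 n tri) n ka;
       chosen (cand2 n tri (chosen (cand1 n tri) n ka)) n kb;
       chosen (tri (chosen (cand1 n tri) n ka)
               (chosen (cand2 n tri (chosen (cand1 n tri) n ka)) n kb)) n kc] (i %/ n)].
  by apply/card_le1_eqP => S S' /H -> /H ->.
case/blowup_triangle_parts => x [y [z [-> [px py pz] [kx ky kz] t]]].
have xm : x %% n < n by rewrite ltn_mod.
have ym : y %% n < n by rewrite ltn_mod.
have zm : z %% n < n by rewrite ltn_mod.
rewrite -tri_mod in t.
rewrite !nth_part // px py pz /= in kx ky kz.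
have ax : x %% n = chosen (cand1 n tri) n ka.
  by apply: u1 => //; apply: (belowI ym); apply: (belowI zm).
rewrite -ax in u2 u3 *.
have by2 : y %% n = chosen (cand2 n tri (x %% n)) n kb.
  by apply: u2 => //; apply: (belowI zm).
rewrite -by2 in u3 *.
have cz : z %% n = chosen (tri (x %% n) (y %% n)) n kc by apply: u3.
rewrite -cz; apply/setP => i; rewrite !inE -!val_eqE /=.
have eqE (u : 'I_(3 * n)) : (val i == val u) = (i %/ n == u %/ n) && (i %% n == u %% n).
  apply/eqP/andP => [->|[/eqP d /eqP m]]; first by rewrite !eqxx.
  by rewrite /= (divn_eq i n) (divn_eq u n) d m.
rewrite !eqE px py pz.
by case: (i %/ n) (part_lt i) => [|[|[|//]]] _ /=; rewrite ?orbF.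
Qed.
End Blowup.

(** * Correctness and running time *)

Lemma pr_pad X d (t : dtree (option X)) f : pr (pad d t) f = pr t f.
Proof.
elim: t d => [[x|]|g IH] d //=; last by rewrite !IH.
by elim: d 0 => [|d IHd] i //=; rewrite !IHd; lra.
Qed.

Lemma pr_call_tree P T m g f :
  pr (call_tree P.1 P.2 T m g) f = pr (run_tree P m g T) (fun o => f (answer_is true o)).
Proof. by rewrite /call_tree pr_bind pr_pad. Qed.

Lemma call_tree_ext wc c T m g g' : (forall q, q < m * m -> g q = g' q) ->
  call_tree wc c T m g = call_tree wc c T m g'.
Proof. by move=> gg; rewrite /call_tree (eq_init _ _ gg). Qed.

(** As [t <= T], the limit [T] does not interrupt the procedure, and the success probability known
    at [t0] carries over to [T]. *)
Lemma pr_answer_ge (P : procedure) m (G : sgraph 'I_m) t T : t <= T ->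
  halts_within P G t ->
  (exists t0, halts_within P G t0 /\
     2 * 2 ^ t0 <= 3 * #|[set r : t0.-tuple bool | answers P G t0 (nth false r) (has_triangle G)]|) ->
  (2%:R / 3%:R <= pr (call_tree P.1 P.2 T m (adj_array G)) (fun b => (b == has_triangle G)%:R))%R.
Proof.
move=> tT ht [t0 [h0 c0]].
have hT : halts_within P G T by move=> tape; apply: run_le (ht tape).
move: c0; rewrite -(ler_nat rat) !natrM card_answers natrX (pr_run_halts _ h0 hT).
rewrite pr_call_tree mulrCA (mulrC 2%:R%R) ler_pM2l; last by rewrite exprn_gt0 ?ltr0n.
move=> h.
apply: (@le_trans _ _ (pr (run_tree P m (adj_array G) T) (fun o => (answer_is (has_triangle G) o)%:R)%R)).
  lra.
apply: ler_pr => o; rewrite ler_nat; case: o => [[k s]|] //=.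
by rewrite eqb_id.
Qed.

(** Because [(8 / 9) ^ 6 < 1 / 2]. *)
Lemma half_pow k : ((8%:R / 9%:R) ^+ (6 * k) <= 2%:R^-1 ^+ k :> rat)%R.
Proof.
rewrite exprM; apply: lerXn2r; rewrite ?nnegrE; last by lra.
  by rewrite exprn_ge0 ?divr_ge0 ?ler0n.
by rewrite invr_ge0 ler0n.
Qed.

(** There are at most [2 ^ (11 + 3 * l)] rounds, each with error at most [2 ^- (16 * l)]; at least
    two halvings are to spare, which leaves [1 / 4]. *)
Lemma rounds_error n :
  ((rounds n)%:R * (8%:R / 9%:R) ^+ threshold n <= 3%:R^-1 :> rat)%R.
Proof.
set l := levels n; have l3 : 3 <= l by rewrite /l /levels; lia.
have -> : threshold n = 6 * (16 * l) by rewrite /threshold -/l; lia.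
have hr : rounds n <= 2 ^ (11 + 3 * l).
  rewrite expnD (mulnC 3) expnM /rounds -[2048]/(2 ^ 11) leq_pmul2l ?expn_gt0 //.
  have := ltn_expl l (isT : 1 < 2) => h.
  by rewrite !expnS expn0 muln1 !leq_mul // ltnW.
apply: (@le_trans _ _ (2%:R ^+ (11 + 3 * l) * 2%:R^-1 ^+ (16 * l))%R).
  apply: ler_pM; [exact: ler0n | | | exact: half_pow].
    by rewrite exprn_ge0 ?divr_ge0 ?ler0n.
  by rewrite -natrX ler_nat.
have -> : 16 * l = (11 + 3 * l) + (2 + (13 * l - 13)) by lia.
move: (11 + 3 * l) (13 * l - 13) => a b.
rewrite !exprD mulrA -exprMn.
have -> : (2%:R * 2%:R^-1 = 1 :> rat)%R by lra.
rewrite expr1n mul1r.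
have : (2%:R^-1 ^+ b <= 1 :> rat)%R by apply: exprn_ile1; lra.
lra.
Qed.

Lemma threshold_half n : ((8%:R / 9%:R) ^+ threshold n <= 2%:R^-1 :> rat)%R.
Proof.
have -> : threshold n = 6 * (16 * levels n) by rewrite /threshold; lia.
apply: (le_trans (half_pow _)).
have -> : 16 * levels n = (16 * levels n).-1.+1 by rewrite /levels; lia.
rewrite exprS; move: _.-1 => k; have : (2%:R^-1 ^+ k <= 1 :> rat)%R by apply: exprn_ile1; lra.
lra.
Qed.

Section Correct.
Context (V : finType) (H : sgraph V) (P : procedure) (C p n : nat) (G : sgraph 'I_n).
Context (hH : ~ colorable 3 H \/ 1 < #|triangles H|) (n0 : 0 < n) (p0 : 0 < p).
Let T := time_limit C p n.
Let w := word_bits (reduction P C p).1 n.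
Let A := adj_array G.
Context (hP : forall G' : sgraph 'I_(3 * n), H_free H G' ->
  (2%:R / 3%:R <= pr (call_tree P.1 P.2 T (3 * n) (adj_array G'))
                    (fun b => (b == has_triangle G')%:R))%R).

Let accept K :=
  pr (vote_tree P.1 P.2 T (3 * n) (threshold n) (part_array w n A K))
     (fun y => (threshold n < y)%:R)%R.

Lemma reduction_word_gt0 : 0 < w.
Proof. by rewrite /w /word_bits /= muln_gt0 /=; lia. Qed.

Lemma H_free_blowup K : #|triangles (blowup n0 G K)| <= 1 -> H_free H (blowup n0 G K).
Proof. exact: H_free_of hH (@blowup_part n n0 G K). Qed.

Lemma call_blowup K :
  call_tree P.1 P.2 T (3 * n) (part_array w n A K) =
  call_tree P.1 P.2 T (3 * n) (adj_array (blowup n0 G K)).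
Proof. by apply: call_tree_ext => q; apply: part_array_blowup; exact: reduction_word_gt0. Qed.

(** Samples of a triangle-free graph are triangle-free, so the promise holds for every [K]. *)
Lemma accept_le K : ~~ has_triangle G ->
  (accept K <= (8%:R / 9%:R) ^+ threshold n)%R.
Proof.
move=> nt; have nB : ~~ has_triangle (blowup n0 G K).
  by apply: contra nt; exact: blowup_triangle.
rewrite /accept /vote_tree call_blowup; apply: pr_votes_high.
have hf : H_free H (blowup n0 G K) by apply: H_free_blowup; move: nB; rewrite /has_triangle -leqNgt; lia.
have := hP hf; rewrite (negbTE nB).
under eq_pr => b do rewrite eqbF_neg.
rewrite (pr_negb _ id); lra.
Qed.

Lemma accept_ge ka kb kc : size ka = n -> size kb = n -> size kc = n ->
  isolated n (tri n0 G) ka kb kc -> (2%:R^-1 <= accept ((ka ++ kb) ++ kc))%R.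
Proof.
move=> sa sb sc iso; set K := _ ++ _.
have tB : has_triangle (blowup n0 G K) by exact: isolated_has_triangle.
have hf : H_free H (blowup n0 G K) by apply: H_free_blowup; exact: isolated_card_triangles.
have := hP hf; rewrite tB.
under eq_pr => b do rewrite eqb_id.
rewrite -call_blowup => y_ge.
have : (1 - accept K <= (8%:R / 9%:R) ^+ threshold n)%R.
  by rewrite /accept -pr_negb; exact: pr_votes_low.
have := threshold_half n; lra.
Qed.

Let round t := round_tree P.1 P.2 T (threshold n) w n A (levels n) t.

Lemma pr_round t : pr (round t) (fun b => b%:R)%R =
  pr (samp n (digit (levels n) 0 t) [::]) (fun ka =>
  pr (samp n (digit (levels n) 1 t) [::]) (fun kb =>
  pr (samp n (digit (levels n) 2 t) [::]) (fun kc => accept ((ka ++ kb) ++ kc)))).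
Proof.
rewrite /round /round_tree pr_bind; apply: eq_pr => ka.
rewrite pr_bind pr_samp_cat; apply: eq_pr => kb.
rewrite pr_bind pr_samp_cat; apply: eq_pr => kc.
by rewrite pr_bind.
Qed.

Lemma round01 t : (0 <= pr (round t) (fun b => b%:R) <= 1)%R.
Proof.
apply/andP; split; first by apply: pr_ge0 => b; exact: ler0n.
exact: (pr_le1 (round t) id).
Qed.

Lemma reduction_tree_correct :
  (2%:R / 3%:R <= pr (reduction_tree P C p n A) (fun b => (b == has_triangle G)%:R))%R.
Proof.
have prE : pr (reduction_tree P C p n A) (fun b => (~~ b)%:R)%R =
   (\prod_(t < rounds n) (1 - pr (round t) (fun b => b%:R)))%R.
  by rewrite /reduction_tree /main_tree pr_any mul1r.
case: (boolP (has_triangle G)) => tG.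
  under eq_pr => b do rewrite eqb_id.
  have := prE; rewrite (pr_negb _ id) => {}prE.
  have le1 := prod_subr_le (rounds n) round01; rewrite -prE in le1.
  move: le1; set y := pr _ _; set S : rat := (\sum_(t < _) _)%R => le1.
  have y1 : (y <= 1)%R by apply: (pr_le1 _ id).
  (* From [(1 + S) * (1 - y) <= 1], [S >= 2] gives [y >= 2 / 3]. *)
  suff S2 : (2%:R <= S)%R.
    have : (0 <= (S - 2%:R) * (1 - y))%R by rewrite mulr_ge0 ?subr_ge0.
    lra.
  have [a [b [c [an bn cn t]]]] := has_triangle_tri n0 tG.
  have iso := isolated_prob an bn cn t.
  pose F i j k := (2%:R^-1 * pr (samp n i [::]) (fun ka => pr (samp n j [::]) (fun kb =>
      pr (samp n k [::]) (fun kc => (isolated n (tri n0 G) ka kb kc)%:R))))%R.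
  have lev0 : 0 < levels n by rewrite /levels; lia.
  apply: (@le_trans _ _ (\sum_(t < rounds n) F (digit (levels n) 0 t) (digit (levels n) 1 t)
       (digit (levels n) 2 t))%R).
    rewrite /rounds (sum_digits F _ lev0).
    have -> : (\sum_(i < levels n) \sum_(j < levels n) \sum_(k < levels n) F i j k =
        2%:R^-1 * \sum_(i < levels n) \sum_(j < levels n) \sum_(k < levels n)
    pr (samp n i [::]) (fun ka => pr (samp n j [::]) (fun kb =>
      pr (samp n k [::]) (fun kc => (isolated n (tri n0 G) ka kb kc)%:R))))%R.
      rewrite mulr_sumr; apply: eq_bigr => i _; rewrite mulr_sumr; apply: eq_bigr => j _.
      by rewrite mulr_sumr.
    (* The constants: [2048 * (1 / 2) * (1 / 512) = 2]. *)
    move: iso; rewrite -/(levels n); set Z : rat := (\sum_(i < _) _)%R => iso; lra.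
  apply: ler_sum => t' _; rewrite pr_round /F -prZ.
  apply: ler_pr_leaves (size_samp _ _) _ => ka sa; rewrite -prZ.
  apply: ler_pr_leaves (size_samp _ _) _ => kb sb; rewrite -prZ.
  apply: ler_pr_leaves (size_samp _ _) _ => kc sc.
  case: (boolP (isolated _ _ _ _ _)) => [iso'|_]; first by rewrite mulr1 accept_ge.
  (* Other samples may violate the promise; nonnegativity is all that is used of them. *)
  by rewrite mulr0; apply: pr_ge0 => y'; exact: ler0n.
under eq_pr => b do rewrite eqbF_neg.
rewrite prE; apply: le_trans (prod_subr_ge _ round01).
have : (\sum_(t < rounds n) pr (round t) (fun b => b%:R) <=
        \sum_(t < rounds n) (8%:R / 9%:R) ^+ threshold n)%R.
  apply: ler_sum => t _; rewrite pr_round.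
  rewrite -[leRHS](pr_cst (samp n (digit (levels n) 0 t) [::])); apply: ler_pr => ka.
  rewrite -[leRHS](pr_cst (samp n (digit (levels n) 1 t) [::])); apply: ler_pr => kb.
  rewrite -[leRHS](pr_cst (samp n (digit (levels n) 2 t) [::])); apply: ler_pr => kc.
  exact: accept_le.
rewrite sumr_const card_ord -mulr_natl; have := rounds_error n; lra.
Qed.
End Correct.

(** * Running time of the reduction *)

Lemma reduction_own_le n : 0 < n ->
  reduction_own n <= 2048 * (100 * 100) * (n * n * (levels n * (levels n * (levels n * levels n)))).
Proof.
move=> n0; rewrite /reduction_own /rounds /round_own /vote_own /threshold /sample_steps.
set l := levels n; have l3 : 3 <= l by rewrite /l /levels; lia.
set r := _ + 2.
have [nl [nX lX]] : n * l <= n * n * l /\ n <= n * n * l /\ l <= n * n * l by nia.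
have h : r + n + 1 <= 90 * 100 * (n * n * l) by rewrite /r; lia.
set L3 := l * (l * l).
have hL : 1 <= L3 by rewrite /L3; nia.
have e : n * n * (l * (l * (l * l))) = n * n * l * L3 by rewrite /L3; lia.
rewrite e; nia.
Qed.

Lemma reduction_steps_le C p n : 0 < n ->
  reduction_steps C p n <=
  2048 * (100 * 100) * (levels n * (levels n * (levels n * levels n))) * (n * n + time_limit C p n).
Proof.
move=> n0; rewrite /reduction_steps; have := reduction_own_le n0.
rewrite /rounds /threshold; set l := levels n; set T := time_limit _ _ _; set o := reduction_own n.
have -> : 2048 * (l * (l * l)) * (2 * (96 * l) * T) = 2048 * 192 * (l * (l * (l * l)) * T) by lia.
set L4 := l * _; nia.
Qed.

Lemma levels_exp p n : 0 < p -> levels n < p * (levels n %/ p + 1).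
Proof. by move=> p0; rewrite addn1 mulnC -ltn_divLR. Qed.

(** With [y = e %/ 4 + 1], [e <= 4 * y] and [y <= 2 ^ (e %/ 4)]. This absorbs the logarithmic
    factors. *)
Lemma pow4_le_exp e : e * (e * (e * e)) <= 256 * 2 ^ e.
Proof.
set y := e %/ 4 + 1.
have ey : e <= 4 * y by rewrite /y; have := divn_eq e 4; have := ltn_pmod e (isT : 0 < 4); lia.
have y2 : y <= 2 ^ (e %/ 4) by rewrite /y addn1 ltn_expl.
have : (2 ^ (e %/ 4)) ^ 4 <= 2 ^ e.
  by rewrite -expnM leq_exp2l // leq_divM.
set x := 2 ^ (e %/ 4) in y2 *; rewrite !expnS expn0 muln1 => h.
have : e * (e * (e * e)) <= 4 * x * (4 * x * (4 * x * (4 * x))).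
  by rewrite !leq_mul //; lia.
lia.
Qed.

(** With [e = levels n %/ p + 1], the time limit and [n * n] are at most constant multiples of
    [2 ^ (e * (3 * p - 2))]; the four logarithmic factors cost one more [2 ^ e]. *)
Lemma reduction_steps_bound C p : 1 < p -> exists B, forall n, 0 < n ->
  reduction_steps C p n <= B * 2 ^ ((levels n %/ p + 1) * (3 * p - 1)).
Proof.
move=> p1; exists (2048 * (100 * 100) * (p * (p * (p * p))) * 256 * (1 + C)) => n n0.
apply: (leq_trans (reduction_steps_le C p n0)).
have p0 : 0 < p by lia.
set l := levels n; set e := l %/ p + 1.
have le : l <= p * e by rewrite ltnW // levels_exp.
have l4 : l * (l * (l * l)) <= p * (p * (p * p)) * (256 * 2 ^ e).
  apply: (@leq_trans (p * e * (p * e * (p * e * (p * e))))); first by rewrite !leq_mul.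
  have -> : p * e * (p * e * (p * e * (p * e))) = p * (p * (p * p)) * (e * (e * (e * e))) by lia.
  by rewrite leq_mul2l pow4_le_exp orbT.
have nn : n * n <= 2 ^ (e * (3 * p - 2)).
  apply: (@leq_trans (2 ^ (e * (2 * p)))); last first.
    by rewrite leq_exp2l // leq_mul2l; apply/orP; right; lia.
  have -> : e * (2 * p) = p * e * 2 by lia.
  rewrite expnM -mulnn leq_mul //.
    have := ltn_levels n; rewrite -/l => h; apply: (@leq_trans (2 ^ l)); first lia.
    by rewrite leq_exp2l.
  have := ltn_levels n; rewrite -/l => h; apply: (@leq_trans (2 ^ l)); first lia.
  by rewrite leq_exp2l.
have -> : e * (3 * p - 1) = e + e * (3 * p - 2).
  have -> : 3 * p - 1 = 1 + (3 * p - 2) by lia.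
  by rewrite mulnDr muln1.
rewrite expnD /time_limit -/l -/e.
move: nn l4; move: (2 ^ (e * (3 * p - 2))) (2 ^ e) (l * (l * (l * l))) (p * (p * (p * p))).
move=> X Y L4 P4 nn l4.
have h : n * n + C * X <= (1 + C) * X by rewrite mulnDl mul1n leq_add2r.
apply: (@leq_trans (2048 * (100 * 100) * (P4 * (256 * Y)) * ((1 + C) * X))).
  by rewrite leq_mul // leq_mul2l l4 orbT.
lia.
Qed.

(** The only [Call] in the reduction is to [P] itself. *)
Lemma combinatorial_reduction (fmm : procedure -> Prop) P C p :
  ~ fmm (reduction P C p) -> combinatorial fmm P -> combinatorial fmm (reduction P C p).
Proof. by case: P => wc c; rewrite /combinatorial /=; tauto. Qed.

Lemma near_linear_glue_reduction P C p : 0 < p -> near_linear_glue (reduction P C p).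
Proof.
move=> p0; exists (2048 * (100 * 100) * 81) => n A tape n0.
have [s [_ o E]] := reduction_run P C A tape n0 p0.
have [k' Ek] := E _ (leqnn _).
exists (reduction_steps C p n), k', s; split; first exact: Ek.
apply: (leq_trans o); apply: (leq_trans (reduction_own_le n0)).
have : levels n <= 3 * (trunc_log 2 n).+1 by rewrite /levels; lia.
have : 0 < (trunc_log 2 n).+1 by [].
have : 4 <= 2048 * (100 * 100) * 81 by lia.
move: (trunc_log 2 n).+1 (levels n) => t l; move: (2048 * (100 * 100)) => c.
(* One constant serves as factor and as exponent. It is kept opaque; the factor 81 is [3 ^ 4], from
   [levels n <= 3 * (trunc_log 2 n).+1]. *)
have [c' c'E] : exists c', c' = c * 81 by exists (c * 81).
rewrite -c'E => c4 t0 lt.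
have t4 : t ^ 4 <= t ^ c' by rewrite leq_pexp2l.
have l4 : l * (l * (l * l)) <= 81 * t ^ 4.
  apply: (@leq_trans (3 * t * (3 * t * (3 * t * (3 * t))))); first by rewrite !leq_mul.
  rewrite !expnS expn0; lia.
apply: (@leq_trans (c * (n * n * (81 * t ^ c')))).
  by rewrite leq_mul2l leq_mul2l (leq_trans l4) ?orbT // leq_mul2l t4 orbT.
by rewrite {2}c'E -mulnn; lia.
Qed.

(** * Passage to real exponents *)

Section Real.
Context (R : realType).
Local Open Scope ring_scope.

Lemma powR_exp2 (e p k : nat) : (0 < p)%N ->
  ((2 ^ (p * e))%N%:R : R) `^ (k%:R / p%:R) = (2 ^ (e * k))%N%:R.
Proof.
move=> p0; have pn : (p%:R : R) != 0 by rewrite pnatr_eq0 -lt0n.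
rewrite mulnC expnM natrX -powR_mulrn ?ler0n // -powRrM mulrCA mulfV // mulr1.
by rewrite powR_mulrn ?ler0n // -natrX -expnM.
Qed.

(** The base [3 * n] is enlarged to [2 ^ (p * e)] and the exponent to [3 - 2 / p], where the real
    power is an integer. *)
Lemma time_limit_ge (C eps : R) (p K n t : nat) : (0 < n)%N -> (0 < p)%N ->
  C <= K%:R -> 2%:R / p%:R <= eps -> t%:R <= C * (3 * n)%N%:R `^ (3%:R - eps) ->
  (t <= time_limit K p n)%N.
Proof.
move=> n0 p0 CK pe ht; rewrite -(ler_nat R); apply: (le_trans ht).
rewrite /time_limit [in leRHS]natrM; set e := (_ + 1)%N.
have pn : (p%:R : R) != 0 by rewrite pnatr_eq0 -lt0n.
have m1 : 1 <= (3 * n)%N%:R :> R by rewrite ler1n; lia.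
have e0 : 0 <= 3%:R - 2%:R / p%:R :> R.
  by rewrite subr_ge0 ler_pdivrMr ?ltr0n // -natrM ler_nat; lia.
apply: (@le_trans _ _ (K%:R * (3 * n)%N%:R `^ (3%:R - eps))).
  by rewrite ler_wpM2r // powR_ge0.
rewrite ler_wpM2l ?ler0n //.
apply: (@le_trans _ _ ((3 * n)%N%:R `^ (3%:R - 2%:R / p%:R))).
  by apply: ler_powR => //; rewrite lerB.
apply: (@le_trans _ _ ((2 ^ (p * e))%N%:R `^ (3%:R - 2%:R / p%:R))).
  apply: ge0_ler_powR; rewrite ?nnegrE ?ler0n // ler_nat.
  apply: (@leq_trans (2 ^ levels n)); first by have := ltn_levels n; lia.
  by rewrite leq_exp2l // ltnW // levels_exp.
rewrite le_eqVlt -(powR_exp2 e _ p0); apply/orP; left; apply/eqP; congr (_ `^ _).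
rewrite natrB; last lia.
by rewrite mulrBl natrM mulfK.
Qed.

(** Rounding the exponent up to a multiple of [p] costs a constant: [2 ^ (p * e)] is at most
    [2 ^ (p + 3) * n]. *)
Lemma exp_levels_le (p B : nat) : (0 < p)%N -> exists B' : R, forall n, (0 < n)%N ->
  (B * 2 ^ ((levels n %/ p + 1) * (3 * p - 1)))%N%:R <= B' * n%:R `^ (3%:R - p%:R^-1).
Proof.
move=> p0; exists (B%:R * (2 ^ (p + 3))%N%:R `^ (3%:R - p%:R^-1)) => n n0.
have pn : (p%:R : R) != 0 by rewrite pnatr_eq0 -lt0n.
rewrite natrM -mulrA ler_wpM2l ?ler0n // -(powR_exp2 _ _ p0).
have -> : (3 * p - 1)%N%:R / p%:R = 3%:R - p%:R^-1 :> R.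
  rewrite natrB; last lia.
  by rewrite mulrBl natrM mulfK // mul1r.
rewrite -powRM ?ler0n // -natrM; apply: ge0_ler_powR; rewrite ?nnegrE ?ler0n //.
  by rewrite subr_ge0 -[_^-1]div1r ler_pdivrMr ?ltr0n // -natrM ler1n; lia.
rewrite ler_nat; apply: (@leq_trans (2 ^ (p + levels n))).
  rewrite leq_exp2l // mulnDr muln1 addnC leq_add2l mulnC; exact: leq_divM.
have -> : (p + levels n = p + 3 + trunc_log 2 n)%N by rewrite /levels; lia.
by rewrite expnD leq_mul2l trunc_logP ?orbT.
Qed.

Lemma exists_exponent (eps : R) : 0 < eps -> exists2 p : nat, (1 < p)%N & 2%:R / p%:R <= eps.
Proof.
move=> e0; have h : 0 <= 2%:R / eps by rewrite divr_ge0 ?ler0n // ltW.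
exists (Num.bound (2%:R / eps) + 2)%N; first lia.
have := archi_boundP h; set b := Num.bound _ => hb.
rewrite ler_pdivrMr ?ltr0n ?addn2 // mulrC -ler_pdivrMr //.
by apply: (le_trans (ltW hb)); rewrite ler_nat; lia.
Qed.
End Real.

Theorem theorem1p4 (R : realType) (fmm : procedure -> Prop)
    (hfmm : fmm_notion fmm) (V : finType) (H : sgraph V) :
  ~ colorable 3 H \/ 1 < #|triangles H| ->
  BMM_conjecture R fmm ->
  forall P : procedure,
    combinatorial fmm P ->
    detects_triangles P (free_graphs H) ->
    requires_cubic_time R P (free_graphs H).
Proof.
move=> hH bmm P combP detP eps eps0 [C timeP].
have [p p1 pe] := exists_exponent eps0.
have p0 : 0 < p by lia.
(* [C] is an arbitrary real, while the program needs a natural constant. *)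
have [K CK] : exists K : nat, (C <= K%:R)%R.
  exists (Num.bound `|C|); apply: (le_trans (ler_norm C)).
  by apply/ltW/archi_boundP; exact: normr_ge0.
have run_ok n (G : sgraph 'I_n) : 0 < n ->
    halts_within (reduction P K p) G (reduction_steps K p n).
  move=> n0 tape; have [s [_ _ E]] := reduction_run P K (adj_array G) tape n0 p0.
  by have [k' ->] := E _ (leqnn _).
(* Of the saving [2 / p] in the exponent, half is spent on logarithmic factors, which leaves
   [1 / p]. *)
apply: (bmm p%:R^-1%R); first by rewrite invr_gt0 ltr0n.
exists (reduction P K p); split.
- by apply: combinatorial_reduction combP; apply: hfmm; exact: near_linear_glue_reduction.
- move=> n G n0 _; exists (reduction_steps K p n); split; first exact: run_ok.
  have hP (G' : sgraph 'I_(3 * n)) : H_free H G' ->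
     (2%:R / 3%:R <= pr (call_tree P.1 P.2 (time_limit K p n) (3 * n) (adj_array G'))
                    (fun b => (b == has_triangle G')%:R))%R.
    move=> free; have n3 : 0 < 3 * n by lia.
    have [t [ht tle]] := timeP _ G' n3 free.
    exact: (pr_answer_ge (time_limit_ge n0 p0 CK pe tle) ht (detP _ G' n3 free)).
  have := reduction_tree_correct G hH n0 p0 hP; set tree := reduction_tree _ _ _ _ _.
  have <- : pr (run_tree (reduction P K p) n (adj_array G) (reduction_steps K p n))
     (fun o => (answer_is (has_triangle G) o)%:R)%R = pr tree (fun b => (b == has_triangle G)%:R)%R.
    apply: eq_pr_trun => tape; rewrite -answer_is_at_res -run_texec.
    have [s [m0 _ E]] := reduction_run P K (adj_array G) tape n0 p0.
    have [k' ->] := E _ (leqnn _).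
    by rewrite /= m0; case: (trun _ _ _).1.
  rewrite -(ler_nat rat) !natrM card_answers natrX.
  set y := pr _ _ => y_ge; rewrite mulrCA mulrC ler_pM2l; last by rewrite exprn_gt0 ?ltr0n.
  lra.
have [B hB] := reduction_steps_bound K p1.
have [B' hB'] := exp_levels_le R B p0.
exists B' => n G n0 _; exists (reduction_steps K p n); split; first exact: run_ok.
by apply: le_trans (hB' n n0); rewrite ler_nat; exact: hB.
Qed.
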